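(* Let $K$ be a non-archimedean local field, $V$ an $n$-dimensional $K$-vector space with basis $v_1,\dots,v_n$, $G=PGL(V)$, and let $\overline X$, $\overline A$, $\varphi:\overline A\to\mathcal S_c$ and $\mathcal S$ be as in the context. Then the map $G\times\overline A\to\mathcal S$, $(g,x)\mapsto g(\varphi(x))$, induces a well-defined $G$-equivariant homeomorphism $\varphi:\overline X\to\mathcal S$.
   Context: Notation: $v$ normalized valuation, $|x|=q^{-v(x)}$ with $q$ the residue field cardinality, $\underline n=\{1,\dots,n\}$; ''$\subset$'' is strict inclusion. $T\subset G$ image of invertible diagonal matrices w.r.t. $v_1,\dots,v_n$, $N$ its normalizer, $N=T\rtimes W$ with $W$ the permutation matrices ($w(v_i)=v_{w(i)}$). Seminorms: a seminorm on $V$ is a map $\gamma:V\to\mathbb R_{\ge0}$, not identically zero, with $\gamma(\lambda x)=|\lambda|\gamma(x)$ and $\gamma(x+y)\le\max\{\gamma(x),\gamma(y)\}$; equivalent seminorms differ by a positive constant factor. $\mathcal S'$ is the set of all seminorms with the topology of pointwise convergence, $\mathcal S$ its quotient by equivalence with the quotient topology; $G$ acts on $\mathcal S$ via $g(\gamma)=\gamma\circ g^{-1}$. $\mathcal S_c\subseteq\mathcal S$ is the set of classes of seminorms canonical w.r.t. $v_1,\dots,v_n$ (i.e. $\gamma(\sum\lambda_iv_i)=\max_i|\lambda_i|\gamma(v_i)$). Compactified apartment: for nonempty $I\subseteq\underline n$, $A_I$ is the real vector space generated by $\overline\eta^I_i$ ($i\in I$) modulo $\sum_{i\in I}\overline\eta^I_i=0$;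 $A=A_{\underline n}$, $\eta_i=\overline\eta_i^{\underline n}$; $s_I:A\to A_I$ linear with $\eta_i\mapsto\overline\eta^I_i$ ($i\in I$), $\eta_i\mapsto0$ ($i\notin I$); $\overline A=\bigsqcup_{\emptyset\ne I\subseteq\underline n}A_I$, with topology having as base the open subsets of $A$ and the sets $\Gamma^I_U=(U+\Delta_I)\cup\bigcup_{I\subseteq J\subset\underline n}s_J(U+\Delta_I)$ for nonempty $I\subset\underline n$, $U\subset A$ open bounded, $\Delta_I=\sum_{i\notin I}\mathbb R_{\ge0}\eta_i$. $N$ acts on $\overline A$ (action $\nu$): $t\in T$ induced by $\mathrm{diag}(d_1,\dots,d_n)$ translates $A_I$ by $\sum_{i\in I}-v(d_i)\overline\eta^I_i$; $w\in W$ maps $A_I\to A_{w(I)}$, $\overline\eta^I_i\mapsto\overline\eta^{w(I)}_{w(i)}$. The map $\varphi:\overline A\to\mathcal S_c$ sends $x=\sum_{i\in I}x_i\overline\eta^I_i\in A_I$ to the class of $\gamma(\sum_k\lambda_kv_k)=\max\{|\lambda_i|q^{-x_i}:i\in I\}$. Groups: for $i\ne j$, $a_{ij}(\sum_kz_k\eta_k)=z_i-z_j$ on $A$, $U_{ij}$ the image in $G$ of the matrices $1+uE_{ij}$; for $x\in\overline A$, $f_x(a_{ij})=\inf\{t: x\in\overline{\{z\in A:a_{ij}(z)\ge-t\}}\}$ (closure in $\overline A$, $\inf\emptyset=\infty$, $\inf\mathbb R=-\infty$), $U_{ij,x}=\{1+uE_{ij}:v(u)\ge f_x(a_{ij})\}$,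 $U_x$ generated by all $U_{ij,x}$, $N_x$ the stabilizer of $x$ in $N$, $P_x=N_xU_x$. $Z=\{t\in T:\nu(t)|_A=\mathrm{id}\}$, $U_0^\wedge=U_0Z$. $\overline X$ is the quotient of $U_0^\wedge\times\overline A$ by $(g,x)\sim(h,y)$ iff $\exists n\in N$ with $\nu(n)x=y$ and $g^{-1}hn\in P_x$ (quotient topology); via the inclusion $U_0^\wedge\subseteq G$ it is homeomorphic to the quotient of $G\times\overline A$ by the relation of the same form, and $G$ acts on $\overline X$ by left multiplication on the first factor of $G\times\overline A$. The induced map in the claim is understood on this quotient of $G\times\overline A$. *)

(* Defs.v *)
From HB Require Import structures.
From mathcomp Require Import all_boot all_order all_algebra.
From mathcomp Require Import all_classical all_reals all_analysis.
From Stdlib Require Import Relations.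
Import Order.TTheory GRing.Theory Num.Theory.
Local Open Scope ring_scope.

Section Defs.
Variable R : realType.
Variable K : fieldType.
(* the normalized valuation v : K^* -> Z (its value at 0 is irrelevant) *)
Variable v : K -> int.
(* q = cardinality of the residue field *)
Variable q : nat.

Definition valring (x : K) : Prop := x = 0 \/ 0 <= v x.

(* K is a non-archimedean local field: complete w.r.t. a discrete valuation v,
   normalized (v(K^x) = Z), with finite residue field O/m of cardinality q. *)
Definition nonarch_local_field : Prop :=
  (forall x y, x != 0 -> y != 0 -> v (x * y) = v x + v y) /\
  (forall x y, x != 0 -> y != 0 -> x + y != 0 ->
     Num.min (v x) (v y) <= v (x + y)) /\
  (exists pi : K, pi != 0 /\ v pi = 1) /\
  (exists s : seq K,
     [/\ size s = q, uniq s, (forall r, r \in s -> valring r),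
       (forall r r', r \in s -> r' \in s -> r != r' -> v (r - r') <= 0) &
       (forall x, valring x -> exists2 r, r \in s & (x - r = 0 \/ 1 <= v (x - r)))]) /\
  (forall u : nat -> K,
     (forall N : int, exists M : nat, forall a b, (M <= a)%N -> (M <= b)%N ->
        u a - u b = 0 \/ N <= v (u a - u b)) ->
     exists l, forall N : int, exists M : nat, forall a, (M <= a)%N ->
        u a - l = 0 \/ N <= v (u a - l)).

Definition absK (x : K) : R := if x == 0 then 0 else (q%:R : R) ^ (- v x).

Variable n : nat.

(* V = K^n (column vectors), with basis v_i = the i-th standard vector *)
Definition Vec := 'cV[K]_n.

Definition seminorm (g : Vec -> R) : Prop :=
  [/\ forall x, 0 <= g x, exists x, g x != 0,
      forall (l : K) x, g (l *: x) = absK l * g x &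
      forall x y, g (x + y) <= Num.max (g x) (g y)].

Definition sn_equiv (g g' : Vec -> R) : Prop :=
  exists2 c : R, 0 < c & forall x, g' x = c * g x.

(* G is represented by invertible matrices *)
Definition GLn (g : 'M[K]_n) : Prop := g \in unitmx.

Definition act (g : 'M[K]_n) (gam : Vec -> R) : Vec -> R :=
  fun x => gam (invmx g *m x).

(* points of Abar: pairs (I, z) where z : I_n -> R is the normalized
   representative of sum_{i in I} z_i eta^I_i (z_i = 0 off I, sum_I z_i = 0) *)
Definition pt := ({set 'I_n} * ('I_n -> R))%type.

Definition normz (I : {set 'I_n}) (z : 'I_n -> R) : 'I_n -> R :=
  fun i => if i \in I then z i - (\sum_(j in I) z j) / (#|I|%:R) else 0.

Definition inAI (I : {set 'I_n}) (z : 'I_n -> R) : Prop :=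
  [/\ I != finset.set0, forall i, i \notin I -> z i = 0 & \sum_(i in I) z i = 0].

Definition inAbar (p : pt) : Prop := inAI p.1 p.2.
Definition inA (z : 'I_n -> R) : Prop := inAI [set: 'I_n] z.

Definition phi (p : pt) : Vec -> R :=
  fun l => \big[Num.max/0]_(i in p.1) (absK (l i ord0) * powR (q%:R) (- p.2 i)).

Definition A_open (U : ('I_n -> R) -> Prop) : Prop :=
  (forall z, U z -> inA z) /\
  forall z, U z -> exists2 e : R, 0 < e &
    forall z', inA z' -> (forall i, `|z' i - z i| < e) -> U z'.

Definition A_bounded (U : ('I_n -> R) -> Prop) : Prop :=
  exists M : R, forall z, U z -> forall i, `|z i| <= M.

Definition plusDelta (I : {set 'I_n}) (U : ('I_n -> R) -> Prop) (w : 'I_n -> R) : Prop :=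
  exists z d, [/\ U z, (forall i, 0 <= d i), (forall i, i \in I -> d i = 0) &
                  w = normz [set: 'I_n] (fun i => z i + d i)].

Definition Gamma (I : {set 'I_n}) (U : ('I_n -> R) -> Prop) (p : pt) : Prop :=
  (p.1 = [set: 'I_n] /\ plusDelta I U p.2) \/
  exists J : {set 'I_n}, [/\ I \subset J, J \proper [set: 'I_n] &
     exists2 w, plusDelta I U w & p = (J, normz J w)].

Definition Abar_base (B : pt -> Prop) : Prop :=
  (exists2 U, A_open U & B = fun p => p.1 = [set: 'I_n] /\ U p.2) \/
  exists I U, [/\ I != finset.set0, I \proper [set: 'I_n], A_open U, A_bounded U &
                  B = Gamma I U].

Definition Abar_open (W : pt -> Prop) : Prop :=
  forall p, W p -> exists B, [/\ Abar_base B, B p & forall p', B p' -> W p'].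

Definition Abar_closure (S : ('I_n -> R) -> Prop) (x : pt) : Prop :=
  forall W, Abar_open W -> W x -> exists z, S z /\ W ([set: 'I_n], z).

Definition fx (x : pt) (i j : 'I_n) : \bar R :=
  ereal_inf (fun e : \bar R => exists t : R, e = t%:E /\
     Abar_closure (fun z => inA z /\ - t <= z i - z j) x).

Definition Uij (x : pt) (i j : 'I_n) (g : 'M[K]_n) : Prop :=
  exists u : K, (u = 0 \/ (fx x i j <= ((v u)%:~R)%:E)%E) /\
                g = 1%:M + u *: delta_mx i j.

Definition Ux (x : pt) (g : 'M[K]_n) : Prop :=
  exists s : seq 'M[K]_n,
    (forall m, m \in s -> exists i j, i != j /\ (Uij x i j m \/ Uij x i j (invmx m))) /\
    g = foldr mulmx 1%:M s.

Definition monomial (g : 'M[K]_n) : Prop :=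
  (forall k, #|[set i | g k i != 0]| = 1%N) /\ (forall i, #|[set k | g k i != 0]| = 1%N).

Definition pos (g : 'M[K]_n) (k : 'I_n) : 'I_n := odflt k [pick i | g k i != 0].

(* the action nu of N on Abar: g = t w with w(v_i) = v_{w(i)}, t = diag(d),
   so g_{k, w^-1 k} = d_k and w^-1 = pos g *)
Definition nu (g : 'M[K]_n) (p : pt) : pt :=
  let J := [set k | pos g k \in p.1] in
  (J, normz J (fun k => p.2 (pos g k) - ((v (g k (pos g k)))%:~R))).

Definition Nx (x : pt) (g : 'M[K]_n) : Prop := monomial g /\ nu g x = x.

Definition Px (x : pt) (g : 'M[K]_n) : Prop :=
  exists a b, [/\ Nx x a, Ux x b & g = a *m b].

Definition Xrel (a b : 'M[K]_n * pt) : Prop :=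
  [/\ GLn a.1, inAbar a.2, GLn b.1, inAbar b.2 &
      exists m, [/\ monomial m, nu m a.2 = b.2 & Px a.2 (invmx a.1 *m b.1 *m m)]].

Definition Xsaturated (W : 'M[K]_n * pt -> Prop) : Prop :=
  forall a b, Xrel a b -> (W a <-> W b).

Definition Phi (a : 'M[K]_n * pt) : Vec -> R := act a.1 (phi a.2).

Definition Sp_open (O : (Vec -> R) -> Prop) : Prop :=
  (forall g, O g -> seminorm g) /\
  forall g, O g -> exists F : seq Vec, exists2 e : R, 0 < e &
    forall g', seminorm g' -> (forall w, w \in F -> `|g' w - g w| < e) -> O g'.

(* open subsets of S = saturated open subsets of S' (quotient topology) *)
Definition S_open (O : (Vec -> R) -> Prop) : Prop :=
  Sp_open O /\
  (forall g g', seminorm g -> seminorm g' -> sn_equiv g g' -> O g -> O g').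

Definition GL_open (O : 'M[K]_n -> Prop) : Prop :=
  forall g, O g -> GLn g /\ exists2 e : R, 0 < e &
    forall h, GLn h -> (forall i j, absK (h i j - g i j) < e) -> O h.

Definition XA_open (W : 'M[K]_n * pt -> Prop) : Prop :=
  forall a, W a -> (GLn a.1 /\ inAbar a.2) /\
    exists O1 O2, [/\ GL_open O1, Abar_open O2, O1 a.1, O2 a.2 &
                      forall g p, O1 g -> O2 p -> W (g, p)].

End Defs.

(* Main.v *)
Require Import Defs.
From HB Require Import structures.
From mathcomp Require Import all_boot all_order all_algebra.
From mathcomp Require Import all_classical all_reals all_analysis.
From mathcomp Require Import ring lra zify.
From Stdlib Require Import Relations.
Set Implicit Arguments.
Unset Strict Implicit.
Unset Printing Implicit Defensive.
Import Order.TTheory GRing.Theory Num.Theory.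
Local Open Scope ring_scope.

(** Every point of the compactified apartment has projective coordinates
    [c_i = q^(- x_i)] ([0] off [I]), and [phi] sends it to the seminorm
    [max_i |y_i| c_i]. In these coordinates the topology is the evident one and
    [U_(ij,x)] consists of the [1 + u E_ij] with [|u| c_i <= c_j], i.e. of those
    preserving [phi x]; so the map is well defined. It is injective because a
    matrix [k] with [phi x \o k] homothetic to [phi y] can be made monomial by
    row operations in [U_x], pivoting on the entries that realize the norm of
    each column. It is surjective because every seminorm is split by a basis of
    the standard lattice, found by splitting off a lattice vector of maximal norm
    with a norming functional (Hahn-Banach over a spherically complete field).
    Lattice bases form a compact set, so if seminorms tend to [gam] along an
    ultrafilter, their splitting data tend to splitting data of [gam]: with
    injectivity this makes the map open. *)

(** * Ultrafilter limits in a local field *)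

(** The boundary shapes the proof: at a point of [A_I] the exponents off [I] are infinite and [phi]
    has a kernel, so formulas in the exponents would split by strata. Weights that may vanish, taken
    up to a common factor, treat all strata alike; [coord_nbhs_open], [open_coord_nbhs] and [fx_leP]
    make the translation once, and afterwards neither [Gamma] nor [fx] is opened. Openness is the
    other obstacle: a splitting basis is far from unique, and no continuous choice of it is at hand.
    So an arbitrary one is chosen for each seminorm, and ultrafilters give the limits without any
    countability of the pointwise topology. Keeping the basis in [GL_n] of the valuation ring makes
    its limit exist and stay invertible; this is why [orthogonal_basis] splits off a vector of
    maximal norm. *)

Section Ultrafilters.
Local Open Scope classical_set_scope.

Lemma ultra_seqU (T : Type) (G : set_system T) (UG : UltraFilter G)
    (I : eqType) (s : seq I) (A : I -> set T) :
  G [set t | exists2 r, r \in s & A r t] -> exists2 r, r \in s & G (A r).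
Proof.
elim: s => [|r s IH] Gs.
  have /filter_ex[t [r]] : G [set t | exists2 r, r \in [::] & A r t] := Gs.
  by rewrite in_nil.
have [GA|GnA] := in_ultra_setVsetC (A r) UG; first by exists r; rewrite ?mem_head.
have /IH[r' r's GA'] : G [set t | exists2 r, r \in s & A r t].
  apply: filterS (filterI Gs GnA) => t /= [[r']].
  by rewrite inE => /predU1P[->//|r's Ar' _]; exists r'.
by exists r'; rewrite // inE r's orbT.
Qed.

(** The limit is the supremum of the levels below [f] on a set of [G]; a level above the supremum
    fails, so maximality of [G] puts [f] below it on a set of [G]. *)
Lemma ultra_limit_real (R : realType) (T : Type) (G : set_system T)
    (UG : UltraFilter G) (f : T -> R) (C : R) :
  G [set t | 0 <= f t <= C] ->
  exists l : R, 0 <= l /\ forall e, 0 < e -> G [set t | `|f t - l| < e].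
Proof.
move=> Gb; pose A := [set r | G [set t | r <= f t]].
have A0 : A 0 by apply: filterS Gb => t /= /andP[].
have ubA : ubound A C.
  move=> r Ar; have [t /= [/andP[_ h1] h2]] := filter_ex (filterI Gb Ar).
  exact: le_trans h2 h1.
have supA : has_sup A by split; [exists 0 | exists C].
exists (sup A); split; first by apply: ub_le_sup => //; exists C.
move=> e e0.
have [r Ar er] := sup_adherent e0 supA.
have Gn : G (~` [set t | sup A + e / 2 <= f t]).
  have [h|//] := in_ultra_setVsetC [set t | sup A + e / 2 <= f t] UG.
  have : sup A + e / 2 <= sup A by apply: ub_le_sup => //; exists C.
  by rewrite gerDl leNgt divr_gt0.
apply: filterS (filterI Ar Gn) => t /= [h1 /negP]; rewrite -ltNge => h2.
rewrite ltr_norml; apply/andP; split; lra.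
Qed.

End Ultrafilters.

(** * Absolute value, digit expansions and spherical completeness *)

Section Valuation.
Local Open Scope classical_set_scope.
Variables (R : realType) (K : fieldType) (v : K -> int) (q : nat).
Hypothesis hK : nonarch_local_field K v q.
Local Notation abs := (absK R K v q).
Local Notation b := (q%:R : R).

Lemma valM x y : x != 0 -> y != 0 -> v (x * y) = v x + v y.
Proof. by case: hK => h _; exact: h. Qed.

Lemma valD x y : x != 0 -> y != 0 -> x + y != 0 -> Num.min (v x) (v y) <= v (x + y).
Proof. by case: hK => _ [h _]; exact: h. Qed.

Lemma val1 : v 1 = 0.
Proof. by have := valM (oner_neq0 K) (oner_neq0 K); rewrite mulr1 -{1}[v 1]addr0 => /addrI. Qed.

Lemma valN1 : v (-1) = 0.
Proof.
have h : (-1 : K) != 0 by rewrite oppr_eq0 oner_eq0.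
have := valM h h; rewrite mulrNN mulr1 val1; lia.
Qed.

Lemma valV x : x != 0 -> v x^-1 = - v x.
Proof.
move=> x0; have := @valM x x^-1 x0; rewrite invr_eq0 divff // val1 => /(_ x0); lia.
Qed.

Lemma q_gt1 : (1 < q)%N.
Proof.
case: hK => _ [_ [_ [[s [sq us sO sD sC]] _]]].
have [r0 r0s h0] : exists2 r, r \in s & (0 - r = 0 \/ 1 <= v (0 - r)).
  by apply: sC; left.
have [r1 r1s h1] : exists2 r, r \in s & (1 - r = 0 \/ 1 <= v (1 - r)).
  by apply: sC; right; rewrite val1.
(* A common representative [r] would write 1 as [(1 - r) + r] with both summands of positive
   valuation; [r = 0] and [r = 1] are set aside because [v 0] is unspecified. *)
have r01 : r0 != r1.
  apply/eqP => e; rewrite -e in h1.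
  have [e0|n0] := eqVneq r0 0.
    move: h1; rewrite e0 subr0 val1 => -[/eqP|//]; by rewrite oner_eq0.
  have [e1|n1] := eqVneq r0 1.
    move: h0; rewrite e1 sub0r valN1 => -[/eqP|//]; by rewrite oppr_eq0 oner_eq0.
  case: h0 => [/eqP|h0]; first by rewrite sub0r oppr_eq0 (negbTE n0).
  case: h1 => [/eqP|h1]; first by rewrite subr_eq0 eq_sym (negbTE n1).
  have v0 : v (0 - r0) = v r0.
    by rewrite sub0r -mulN1r valM ?oppr_eq0 ?oner_eq0 // valN1 add0r.
  have := @valD (1 - r0) r0; rewrite subrK val1 subr_eq0 eq_sym => /(_ n1 n0 (oner_neq0 _)).
  lia.
rewrite -sq; case: s r0s r1s {us sO sD sC sq} => [|a [|c s]] //.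
by rewrite !inE => /eqP e0 /eqP e1; rewrite e0 e1 eqxx in r01.
Qed.

Lemma q_gt1R : 1 < b.
Proof. by rewrite ltr1n q_gt1. Qed.

Lemma q_gt0R : 0 < b.
Proof. exact: lt_trans ltr01 q_gt1R. Qed.

Lemma absK0 : abs 0 = 0.
Proof. by rewrite /absK eqxx. Qed.

Lemma absK_neq0E x : x != 0 -> abs x = b ^ (- v x).
Proof. by rewrite /absK => /negbTE ->. Qed.

Lemma absK_ge0 x : 0 <= abs x.
Proof.
by rewrite /absK; case: ifP => // _; rewrite ltW // exprz_gt0 // q_gt0R.
Qed.

Lemma absK_gt0 x : (0 < abs x) = (x != 0).
Proof.
rewrite /absK; case: eqVneq => [_|_]; first by rewrite ltxx.
by rewrite exprz_gt0 // q_gt0R.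
Qed.

Lemma absK_eq0 x : (abs x == 0) = (x == 0).
Proof. by apply/negb_inj; rewrite -absK_gt0 lt_neqAle absK_ge0 andbT eq_sym. Qed.

Lemma absKM x y : abs (x * y) = abs x * abs y.
Proof.
have [->|x0] := eqVneq x 0; first by rewrite mul0r absK0 mul0r.
have [->|y0] := eqVneq y 0; first by rewrite mulr0 absK0 mulr0.
rewrite !absK_neq0E ?mulf_neq0 // valM // opprD expfzDr //.
by rewrite gt_eqF // q_gt0R.
Qed.

Lemma absK1 : abs 1 = 1.
Proof. by rewrite absK_neq0E ?oner_neq0 // val1 oppr0 expr0z. Qed.

Lemma absKN x : abs (- x) = abs x.
Proof.
rewrite -mulN1r absKM absK_neq0E ?oppr_eq0 ?oner_neq0 // valN1 oppr0 expr0z.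
by rewrite mul1r.
Qed.

Lemma absKV x : abs x^-1 = (abs x)^-1.
Proof.
have [->|x0] := eqVneq x 0; first by rewrite invr0 absK0 invr0.
apply: (mulfI (x := abs x)); first by rewrite absK_eq0.
by rewrite -absKM !divff ?absK_eq0 // absK1.
Qed.

Lemma exprz_qle (i j : int) : (b ^ i <= b ^ j) = (i <= j).
Proof. by rewrite ler_eXz2l // q_gt1R. Qed.

Lemma absKD x y : abs (x + y) <= Num.max (abs x) (abs y).
Proof.
have [->|x0] := eqVneq x 0; first by rewrite add0r le_max lexx orbT.
have [->|y0] := eqVneq y 0; first by rewrite addr0 le_max lexx.
have [->|s0] := eqVneq (x + y) 0; first by rewrite absK0 le_max absK_ge0.
by rewrite le_max !absK_neq0E // !exprz_qle !lerN2 -ge_min valD.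
Qed.

Lemma absKB x y : abs (x - y) <= Num.max (abs x) (abs y).
Proof. by rewrite -(absKN y) absKD. Qed.

Lemma absKD_le x y t : abs x <= t -> abs y <= t -> abs (x + y) <= t.
Proof. by move=> h1 h2; rewrite (le_trans (absKD _ _)) // ge_max h1. Qed.

Lemma absKB_le x y t : abs x <= t -> abs y <= t -> abs (x - y) <= t.
Proof. by move=> h1 h2; rewrite absKD_le ?absKN. Qed.

Lemma absK_sum (I : Type) (s : seq I) (P : pred I) (F : I -> K) (t : R) :
  0 <= t -> (forall i, P i -> abs (F i) <= t) -> abs (\sum_(i <- s | P i) F i) <= t.
Proof.
move=> t0 h; elim/big_rec: _ => [|i x Pi ih]; first by rewrite absK0.
by rewrite absKD_le // h.
Qed.

Lemma absKD_eq x y : abs y < abs x -> abs (x + y) = abs x.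
Proof.
move=> yx; apply/eqP; rewrite eq_le absKD_le ?lexx ?(ltW yx) //=.
rewrite leNgt; apply/negP => h.
have := absKB (x + y) y; rewrite addrK le_max => /orP[].
  by rewrite leNgt h.
by rewrite leNgt yx.
Qed.

Lemma absK_leP (N : int) x : (abs x <= b ^ (- N)) <-> (x = 0 \/ N <= v x).
Proof.
have [->|x0] := eqVneq x 0.
  by rewrite absK0; split=> [|_]; [left | rewrite ltW // exprz_gt0 // q_gt0R].
rewrite absK_neq0E // exprz_qle lerN2; split; first by right.
by case=> // /eqP; rewrite (negbTE x0).
Qed.

Lemma exists_val (N : int) : exists2 x : K, x != 0 & v x = N.
Proof.
case: hK => _ [_ [[p [p0 vp]] _]].
have nat_case (m : nat) : exists2 x : K, x != 0 & v x = m.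
  exists (p ^+ m); first by rewrite expf_neq0.
  elim: m => [|m IH]; first by rewrite expr0 val1.
  by rewrite exprS valM ?expf_neq0 // vp IH; lia.
case: (intP N) => [|m|m]; first exact: (nat_case 0%N).
- exact: (nat_case m.+1).
- have [x x0 vx] := nat_case m.+1; exists x^-1; first by rewrite invr_eq0.
  by rewrite valV // vx.
Qed.

Lemma exprz_q_large (C : R) : exists N : int, C <= b ^ (- N).
Proof.
have [m hm] : exists m : nat, C < m%:R.
  exists (Num.bound `|C|); apply: le_lt_trans (ler_norm C) _.
  exact: archi_boundP.
exists (- m%:Z); rewrite opprK -exprnP; apply/ltW/(lt_trans hm).
by rewrite -natrX ltr_nat ltn_expl // q_gt1.
Qed.

Lemma exprz_q_small (e : R) : 0 < e -> exists N : int, b ^ (- N) < e.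
Proof.
move=> e0; have [N hN] := exprz_q_large (e^-1 + 1); exists (- N).
have bN : 0 < b ^ (- N) by rewrite exprz_gt0 // q_gt0R.
rewrite -invr_expz -(invrK e) ltf_pV2 ?posrE ?invr_gt0 //.
by apply: lt_le_trans hN; rewrite ltrDl.
Qed.

(** Residue representatives multiplied by an element of valuation [N] serve as digits at level [N];
    what matters is that the list does not depend on [x]. *)
Lemma residue_step (N : int) : exists s : seq K, forall x,
  abs x <= b ^ (- N) -> exists2 r, r \in s & abs (x - r) <= b ^ (- (N + 1)).
Proof.
have [p p0 vp] := exists_val N.
case: hK => _ [_ [_ [[s [_ _ _ _ sC]] _]]].
exists [seq p * r | r <- s] => x hx.
have [|r rs hr] := sC (x / p).
  apply/absK_leP; rewrite oppr0 expr0z absKM absKV ler_pdivrMr ?absK_gt0 //.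
  by rewrite mul1r (absK_neq0E p0) vp.
exists (p * r); first exact: map_f.
have -> : x - p * r = p * (x / p - r) by rewrite mulrBr mulrCA divff ?mulr1.
rewrite absKM (absK_neq0E p0) vp opprD expfzDr ?gt_eqF ?q_gt0R //.
by rewrite ler_pM2l ?exprz_gt0 ?q_gt0R //; apply/absK_leP.
Qed.

(* Finiteness of the residue field pins down one more digit at each step along the ultrafilter; completeness then gives the limit. *)
Lemma ultra_limit (T : Type) (G : set_system T) (UG : UltraFilter G)
    (f : T -> K) (C : R) : G [set t | abs (f t) <= C] ->
  exists l, forall e, 0 < e -> G [set t | abs (f t - l) < e].
Proof.
move=> Gb; have [N0 hN0] := exprz_q_large C.
have digit (m : nat) : exists a, G [set t | abs (f t - a) <= b ^ (- (N0 + m%:Z))].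
  elim: m => [|m [a Ga]].
    exists 0; apply: filterS Gb => t /=; rewrite subr0 addr0 => h.
    exact: le_trans h hN0.
  have [s hs] := residue_step (N0 + m%:Z).
  have Gs : G [set t | exists2 r, r \in s &
      abs (f t - (a + r)) <= b ^ (- (N0 + m.+1%:Z))].
    apply: filterS Ga => t /= /hs[r rs hr]; exists r => //.
    by rewrite opprD addrA -addn1 PoszD addrA.
  by have [r _ Gr] := ultra_seqU UG Gs; exists (a + r).
have [a Ga] := choice digit.
case: hK => _ [_ [_ [_ complete]]].
have [l hl] : exists l, forall N : int, exists M : nat, forall i, (M <= i)%N ->
    a i - l = 0 \/ N <= v (a i - l).
  apply: complete => N; exists `|N - N0|%N => i j hi hj.
  have [t /= [ti tj]] := filter_ex (filterI (Ga i) (Ga j)).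
  apply/absK_leP; have -> : a i - a j = (f t - a j) - (f t - a i) by ring.
  apply: absKB_le.
    by apply: le_trans tj _; rewrite exprz_qle; lia.
  by apply: le_trans ti _; rewrite exprz_qle; lia.
exists l => e e0; have [N hN] := exprz_q_small e0.
have [M hM] := hl N; pose i := maxn M `|N - N0|.
have iM : (M <= i)%N by rewrite leq_maxl.
have iN : (`|N - N0|%N <= i)%N by rewrite leq_maxr.
apply: filterS (Ga i) => t /= ht; apply: le_lt_trans hN.
have -> : f t - l = (f t - a i) + (a i - l) by ring.
apply: absKD_le; last by apply/absK_leP/hM.
by apply: le_trans ht _; rewrite exprz_qle; lia.
Qed.

(* One-dimensional Hahn-Banach step: balls that pairwise meet are nested. *)
Lemma balls_meet (I : Type) (i0 : I) (c : I -> K) (r : I -> R) :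
  (forall i, 0 <= r i) ->
  (forall i j, abs (c i - c j) <= Num.max (r i) (r j)) ->
  exists l, forall i, abs (l - c i) <= r i.
Proof.
move=> r0 h; pose B i := [set x | abs (x - c i) <= r i].
have BB i j : r i <= r j -> B i `<=` B j.
  rewrite /B => ij x /= hx; have -> : x - c j = (x - c i) + (c i - c j) by ring.
  apply: absKD_le; first exact: le_trans hx ij.
  by apply: le_trans (h i j) _; rewrite ge_max ij lexx.
have FF : ProperFilter (filter_from [set: I] B).
  apply: filter_from_proper; last first.
    by move=> i _; exists (c i); rewrite /B /= subrr absK0.
  apply: filter_from_filter; first by exists i0.
  move=> i j _ _; have [ij|/ltW ij] := leP (r i) (r j).
    by exists i => // x Bx; split => //; apply: BB Bx.
  by exists j => // x Bx; split => //; apply: BB Bx.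
have [G [UG FG]] := ultraFilterLemma FF.
have GB i : G (B i) by apply: FG; exists i.
have [|l hl] := @ultra_limit _ G UG id (Num.max (r i0) (abs (c i0))).
  apply: filterS (GB i0) => x /= hx.
  have -> : x = (x - c i0) + c i0 by rewrite subrK.
  by apply: absKD_le; rewrite le_max ?hx ?lexx ?orbT.
(* Otherwise some [x] in [B i] is nearer to [l] than [c i] is, and the ultrametric equality makes
   [x] as far from [c i] as [l]. *)
exists l => i; rewrite leNgt; apply/negP => hi.
have e0 : 0 < abs (l - c i) by apply: le_lt_trans (r0 i) hi.
have [x /= [xl xi]] := filter_ex (filterI (hl _ e0) (GB i)).
suff : abs (l - c i) <= r i by rewrite leNgt hi.
rewrite -(absKD_eq xl).
by have -> : (l - c i) + (x - l) = x - c i by ring.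
Qed.

End Valuation.

(** * Canonical seminorms and coordinates on the compactified apartment *)

Lemma normz_in (R : realType) (n : nat) (I : {set 'I_n}) (z : 'I_n -> R) i : i \in I ->
  normz R n I z i = z i - (\sum_(j in I) z j) / #|I|%:R.
Proof. by rewrite /normz => ->. Qed.

Lemma normz_out (R : realType) (n : nat) (I : {set 'I_n}) (z : 'I_n -> R) i : i \notin I ->
  normz R n I z i = 0.
Proof. by rewrite /normz => /negbTE ->. Qed.

Lemma inAI_normz (R : realType) (n : nat) (I : {set 'I_n}) (z : 'I_n -> R) :
  I != finset.set0 -> inAI R n I (normz R n I z).
Proof.
move=> I0; split=> //; first exact: normz_out.
rewrite (eq_bigr (fun i => z i - (\sum_(j in I) z j) / #|I|%:R)); last first.
  by move=> i iI; rewrite normz_in.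
rewrite sumrB sumr_const -[(_ / _) *+ _]mulr_natr divfK ?subrr //.
by rewrite pnatr_eq0 -lt0n card_gt0.
Qed.

(** Points of [A_I] are vectors modulo constants, and centering at mean zero removes the constant.
    Equalities of points are mostly proved by exhibiting the shift. *)
Lemma normz_shift (R : realType) (n : nat) (I : {set 'I_n}) (z w : 'I_n -> R) (s : R) :
  (forall i, i \in I -> z i = w i + s) -> normz R n I z = normz R n I w.
Proof.
move=> h; apply/funext => i; have [iI|iI] := boolP (i \in I); last by rewrite !normz_out.
rewrite !normz_in // h // (eq_bigr (fun i => w i + s)) //.
rewrite big_split sumr_const -[s *+ _]mulr_natr mulrDl mulfK; first by ring.
by rewrite pnatr_eq0 -lt0n card_gt0; apply/set0Pn; exists i.
Qed.

Lemma normz_id (R : realType) (n : nat) (I : {set 'I_n}) (z : 'I_n -> R) :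
  inAI R n I z -> normz R n I z = z.
Proof.
move=> [_ z0 sz]; apply/funext => i; have [iI|iI] := boolP (i \in I).
  by rewrite normz_in // sz mul0r subr0.
by rewrite normz_out // z0.
Qed.

Lemma col_sum_delta (K : fieldType) (n : nat) (y : 'cV[K]_n) :
  y = \sum_i y i ord0 *: delta_mx i ord0.
Proof.
apply/colP => i; rewrite summxE (bigD1 i) //= !mxE !eqxx mulr1 big1 ?addr0 //.
by move=> j ji; rewrite !mxE eq_sym (negbTE ji) mulr0.
Qed.

Section Seminorms.
Variables (R : realType) (K : fieldType) (v : K -> int) (q n : nat).
Hypothesis hK : nonarch_local_field K v q.
Local Notation abs := (absK R K v q).
Local Notation b := (q%:R : R).
Implicit Types (p : pt R n) (c : 'I_n -> R) (y : 'cV[K]_n) (f : 'cV[K]_n -> R).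

Definition cphi c y : R := \big[Num.max/0]_i (abs (y i ord0) * c i).

Definition coord (p : pt R n) : 'I_n -> R :=
  fun i => if i \in p.1 then b `^ (- p.2 i) else 0.

(** Inverse of [coord] up to scale. The logarithm of a vanishing weight is a junk value that [normz]
    discards, its index being outside [I]. *)
Definition ofcoord c : pt R n :=
  let I := [set i | 0 < c i] in (I, normz R n I (fun i => - (ln (c i) / ln b))).

(** Unlike [seminorm], this is stable under composition with any matrix and covers [cphi] of zero
    weights. *)
Definition presem f := [/\ forall x, 0 <= f x,
  forall (l : K) x, f (l *: x) = abs l * f x &
  forall x y, f (x + y) <= Num.max (f x) (f y)].

Lemma powR_gt0b r : 0 < b `^ r.
Proof. by rewrite powR_gt0 // (q_gt0R R hK). Qed.

Lemma powRDb r s : b `^ (r + s) = b `^ r * b `^ s.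
Proof. by rewrite powRD // (gt_eqF (q_gt0R R hK)) implybT. Qed.

Lemma ln_b_gt0 : 0 < ln b.
Proof. by rewrite ln_gt0 // (q_gt1R R hK). Qed.

Lemma powR_ln_div r : 0 < r -> b `^ (ln r / ln b) = r.
Proof.
move=> r0; apply: ln_inj; rewrite ?posrE ?powR_gt0b //.
by rewrite ln_powR divfK // gt_eqF // ln_b_gt0.
Qed.

Lemma ltr_powRb r s : (b `^ r < b `^ s) = (r < s).
Proof.
by rewrite -[LHS]ltr_ln ?posrE ?powR_gt0b // !ln_powR ltr_pM2r // ln_b_gt0.
Qed.

Lemma ler_powRb r s : (b `^ r <= b `^ s) = (r <= s).
Proof. by rewrite !leNgt ltr_powRb. Qed.

Lemma powRb_inj r s : b `^ r = b `^ s -> r = s.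
Proof.
by move=> e; apply/eqP; rewrite eq_le -[X in X && _]ler_powRb -[X in _ && X]ler_powRb e lexx.
Qed.

Lemma absK_powR x : x != 0 -> abs x = b `^ (- (v x)%:~R).
Proof. by move=> x0; rewrite absK_neq0E // -mulrNz powR_intmul // ler0n. Qed.

Lemma coord_ge0 p i : 0 <= coord p i.
Proof. by rewrite /coord; case: ifP => // _; rewrite ltW // powR_gt0b. Qed.

Lemma coord_gt0 p i : (0 < coord p i) = (i \in p.1).
Proof. by rewrite /coord; case: ifP => // _; rewrite ?powR_gt0b ?ltxx. Qed.

Lemma coord_in p i : i \in p.1 -> coord p i = b `^ (- p.2 i).
Proof. by rewrite /coord => ->. Qed.

Lemma coord_neq0 p : inAbar R n p -> exists i, 0 < coord p i.
Proof. by move=> [/set0Pn[i iI] _ _]; exists i; rewrite coord_gt0. Qed.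

Lemma coord_normz (I : {set 'I_n}) (z : 'I_n -> R) : exists2 l : R, 0 < l &
  forall i, coord (I, normz R n I z) i = l * (if i \in I then b `^ (- z i) else 0).
Proof.
exists (b `^ ((\sum_(j in I) z j) / #|I|%:R)); first exact: powR_gt0b.
move=> i; rewrite /coord /=; case: ifP => iI; last by rewrite mulr0.
by rewrite normz_in // -powRDb opprB.
Qed.

Lemma ofcoord_inAbar c : (exists i, 0 < c i) -> inAbar R n (ofcoord c).
Proof.
by move=> [i ci]; apply: inAI_normz; apply/set0Pn; exists i; rewrite inE.
Qed.

Lemma coord_ofcoord c : (forall i, 0 <= c i) ->
  exists2 l : R, 0 < l & forall i, coord (ofcoord c) i = l * c i.
Proof.
move=> c0; have [l l0 hl] := coord_normz [set i | 0 < c i] (fun i => - (ln (c i) / ln b)).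
exists l => // i; rewrite hl inE; case: ifP => ci; first by rewrite opprK powR_ln_div.
by congr (_ * _); apply/eqP; rewrite eq_sym; move: (c0 i); rewrite le_eqVlt ci orbF eq_sym.
Qed.

Lemma coord_inj p p' l : inAbar R n p -> inAbar R n p' -> 0 < l ->
  (forall i, coord p i = l * coord p' i) -> p = p'.
Proof.
case: p => I z; case: p' => I' z' [/= I0 z0 sz] [/= _ z'0 sz'] l0 h.
have II' : I = I'.
  by apply/setP => i; rewrite -(coord_gt0 (I, z)) -(coord_gt0 (I', z')) h pmulr_rgt0.
rewrite -{I'}II' in z'0 sz' h *; congr pair.
have e i : i \in I -> z i = z' i + - (ln l / ln b).
  move=> iI; have := h i; rewrite !coord_in // -{1}[l](powR_ln_div l0) -powRDb.
  by move/powRb_inj => /= e; rewrite -[z i]opprK e opprD opprK addrC.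
by rewrite -(@normz_id _ _ I z) // -(@normz_id _ _ I z') //; apply: normz_shift e.
Qed.

Lemma cphi_ge0 c y : 0 <= cphi c y.
Proof. exact: bigmax_ge_id. Qed.

Lemma cphi_ge c y i : abs (y i ord0) * c i <= cphi c y.
Proof. exact: le_bigmax. Qed.

Lemma cphi_le c y t : 0 <= t -> (forall i, abs (y i ord0) * c i <= t) -> cphi c y <= t.
Proof. by move=> t0 h; apply: bigmax_le. Qed.

Lemma cphi_scale c c' l y : 0 < l -> (forall i, c' i = l * c i) -> cphi c' y = l * cphi c y.
Proof.
move=> l0 h; apply/eqP; rewrite eq_le; apply/andP; split.
  apply: cphi_le => [|i]; first by rewrite mulr_ge0 ?cphi_ge0 // ltW.
  by rewrite h mulrCA ler_pM2l // cphi_ge.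
rewrite mulrC -ler_pdivlMr //; apply: cphi_le => [|i].
  by rewrite divr_ge0 ?cphi_ge0 // ltW.
by rewrite ler_pdivlMr // -mulrA [_ * l]mulrC -h cphi_ge.
Qed.

Lemma phiE p y : phi R K v q n p y = cphi (coord p) y.
Proof.
apply/eqP; rewrite eq_le; apply/andP; split.
  apply: bigmax_le => [|i iI]; first exact: cphi_ge0.
  by rewrite -coord_in // cphi_ge.
apply: cphi_le => [|i]; first exact: bigmax_ge_id.
rewrite /coord; case: ifP => iI; last by rewrite mulr0 bigmax_ge_id.
exact: (le_bigmax_cond _ (fun i => abs (y i ord0) * b `^ (- p.2 i))).
Qed.

Lemma cphi_delta c i : (forall i, 0 <= c i) -> cphi c (delta_mx i ord0) = c i.
Proof.
move=> c0; apply/eqP; rewrite eq_le; apply/andP; split; last first.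
  by have := cphi_ge c (delta_mx i ord0) i; rewrite mxE !eqxx (absK1 R hK) mul1r.
apply: cphi_le => // j; rewrite mxE eqxx andbT.
by case: eqVneq => [->|_]; rewrite ?(absK1 R hK) ?mul1r // absK0 mul0r.
Qed.

Lemma presem_cphi c : (forall i, 0 <= c i) -> presem (cphi c).
Proof.
move=> c0; split=> [x|l x|x y]; first exact: cphi_ge0.
- apply/eqP; rewrite eq_le; apply/andP; split.
    apply: cphi_le => [|i]; first by rewrite mulr_ge0 ?cphi_ge0 ?(absK_ge0 R hK).
    rewrite mxE (absKM R hK) -mulrA ler_wpM2l ?(absK_ge0 R hK) ?cphi_ge //.
  have [->|l0] := eqVneq l 0; first by rewrite absK0 mul0r cphi_ge0.
  have al : 0 < abs l by rewrite (absK_gt0 R hK).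
  rewrite mulrC -ler_pdivlMr //; apply: cphi_le => [|i].
    by rewrite divr_ge0 ?cphi_ge0 // ltW.
  rewrite ler_pdivlMr // mulrC mulrA -(absKM R hK).
  by have := cphi_ge c (l *: x) i; rewrite mxE.
- apply: cphi_le => [|i]; first by rewrite le_max cphi_ge0.
  rewrite mxE.
  have := absKD R hK (x i ord0) (y i ord0); rewrite le_max => /orP[] h.
    by rewrite le_max; apply/orP; left; apply: le_trans (cphi_ge c x i); exact: ler_wpM2r.
  by rewrite le_max; apply/orP; right; apply: le_trans (cphi_ge c y i); exact: ler_wpM2r.
Qed.

Lemma presem_comp f (k : 'M[K]_n) : presem f -> presem (fun y => f (k *m y)).
Proof.
by move=> [f0 fZ fD]; split=> [//|l x|x y]; rewrite -?scalemxAr ?fZ // mulmxDr.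
Qed.

Lemma presem_seminorm f : presem f -> (exists x, f x != 0) -> seminorm R K v q n f.
Proof. by move=> [f0 fZ fD] fn0; split. Qed.

Lemma seminorm_presem f : seminorm R K v q n f -> presem f.
Proof. by case=> f0 _ fZ fD; split. Qed.

Section Presem.
Variable f : 'cV[K]_n -> R.
Hypothesis hf : presem f.

Lemma presem_ge0 x : 0 <= f x. Proof. by case: hf. Qed.

Lemma presemZ l x : f (l *: x) = abs l * f x. Proof. by case: hf. Qed.

Lemma presem0 : f 0 = 0.
Proof. by rewrite -(scale0r (0 : 'cV[K]_n)) presemZ absK0 mul0r. Qed.

Lemma presemN x : f (- x) = f x.
Proof. by rewrite -scaleN1r presemZ (absKN R hK) (absK1 R hK) mul1r. Qed.

Lemma presemD_le x y t : f x <= t -> f y <= t -> f (x + y) <= t.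
Proof. by case: hf => _ _ fD hx hy; rewrite (le_trans (fD x y)) // ge_max hx. Qed.

Lemma presemB_le x y t : f x <= t -> f y <= t -> f (x - y) <= t.
Proof. by move=> hx hy; rewrite presemD_le ?presemN. Qed.

Lemma presem_sum (I : Type) (s : seq I) (P : pred I) (F : I -> 'cV[K]_n) t :
  0 <= t -> (forall i, P i -> f (F i) <= t) -> f (\sum_(i <- s | P i) F i) <= t.
Proof.
move=> t0 h; elim/big_rec: _ => [|i x Pi ih]; first by rewrite presem0.
by rewrite presemD_le // h.
Qed.

Lemma presem_le_cphi y : f y <= cphi (fun i => f (delta_mx i ord0)) y.
Proof.
rewrite [X in f X]col_sum_delta; apply: presem_sum => [|i _]; first exact: cphi_ge0.
by rewrite presemZ (cphi_ge (fun i => f (delta_mx i ord0))).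
Qed.

Lemma presem_dist x y : `|f x - f y| <= f (x - y).
Proof.
have fB : f (y - x) = f (x - y) by rewrite -opprB presemN.
rewrite ler_norml; apply/andP; split.
  have : f y <= Num.max (f (y - x)) (f x) by rewrite -{1}(subrK x y); case: hf.
  rewrite fB le_max => /orP[]; have := presem_ge0 x; have := presem_ge0 (x - y); lra.
have : f x <= Num.max (f (x - y)) (f y) by rewrite -{1}(subrK y x); case: hf.
rewrite le_max => /orP[]; have := presem_ge0 y; have := presem_ge0 (x - y); lra.
Qed.

End Presem.

(** A maximum is 1-Lipschitz in its terms. Products are compared, rather than entries and weights
    separately, because both vary in [act_cphi_cts]. *)
Lemma cphi_dist c c' y y' e : 0 <= e -> (forall i, 0 <= c i) -> (forall i, 0 <= c' i) ->
  (forall i, `|abs (y i ord0) * c i - abs (y' i ord0) * c' i| <= e) ->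
  `|cphi c y - cphi c' y'| <= e.
Proof.
move=> e0 c0 c'0 h.
have h1 : cphi c' y' <= cphi c y + e.
  apply: cphi_le => [|i]; first by rewrite addr_ge0 ?cphi_ge0.
  by have := h i; have := cphi_ge c y i; rewrite ler_norml => ? /andP[]; lra.
have h2 : cphi c y <= cphi c' y' + e.
  apply: cphi_le => [|i]; first by rewrite addr_ge0 ?cphi_ge0.
  by have := h i; have := cphi_ge c' y' i; rewrite ler_norml => ? /andP[]; lra.
by rewrite ler_norml; apply/andP; split; lra.
Qed.

Lemma sn_equiv_refl f : sn_equiv R K n f f.
Proof. by exists 1 => // x; rewrite mul1r. Qed.

Lemma sn_equiv_sym f g : sn_equiv R K n f g -> sn_equiv R K n g f.
Proof.
move=> [c c0 h]; exists c^-1; first by rewrite invr_gt0.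
by move=> x; rewrite h mulKf // gt_eqF.
Qed.

Lemma sn_equiv_trans f g h : sn_equiv R K n f g -> sn_equiv R K n g h -> sn_equiv R K n f h.
Proof.
move=> [c c0 fg] [d d0 gh]; exists (d * c); first exact: mulr_gt0.
by move=> x; rewrite gh fg mulrA.
Qed.

Lemma sn_equiv_act (g : 'M[K]_n) f h :
  sn_equiv R K n f h -> sn_equiv R K n (act R K n g f) (act R K n g h).
Proof. by move=> [c c0 fh]; exists c => // x; rewrite /act fh. Qed.

Lemma invmxM (g h : 'M[K]_n) : g \in unitmx -> h \in unitmx ->
  invmx (g *m h) = invmx h *m invmx g.
Proof.
move=> gU hU; have ghU : g *m h \in unitmx by rewrite unitmx_mul gU.
apply: (can_inj (mulmxK ghU)) => /=.
by rewrite mulVmx // -mulmxA (mulmxA (invmx g)) mulVmx // mul1mx mulVmx.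
Qed.

Lemma act_mul (g h : 'M[K]_n) f : g \in unitmx -> h \in unitmx ->
  act R K n (g *m h) f = act R K n g (act R K n h f).
Proof. by move=> gU hU; apply/funext => x; rewrite /act invmxM // mulmxA. Qed.

Lemma phi_presem p : presem (phi R K v q n p).
Proof.
have -> : phi R K v q n p = cphi (coord p) by apply/funext => y; rewrite phiE.
exact/presem_cphi/coord_ge0.
Qed.

Lemma Phi_seminorm (a : 'M[K]_n * pt R n) :
  GLn K n a.1 -> inAbar R n a.2 -> seminorm R K v q n (Phi R K v q n a).
Proof.
case: a => g p /= gU pA; apply: presem_seminorm.
  exact: (presem_comp (invmx g) (phi_presem p)).
have [i ci] := coord_neq0 pA; exists (g *m delta_mx i ord0).
rewrite /Phi /act /= mulKmx // phiE cphi_delta ?gt_eqF //.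
exact: coord_ge0.
Qed.

Lemma phi_inj p p' : inAbar R n p -> inAbar R n p' ->
  sn_equiv R K n (phi R K v q n p) (phi R K v q n p') -> p = p'.
Proof.
move=> pA p'A [l l0 h]; symmetry; apply: (coord_inj (l := l)) => // i.
by have := h (delta_mx i ord0); rewrite !phiE !cphi_delta //; exact: coord_ge0.
Qed.

Lemma sn_equiv_cphi c (g : 'M[K]_n) : (forall i, 0 <= c i) ->
  sn_equiv R K n (act R K n g (cphi c)) (Phi R K v q n (g, ofcoord c)).
Proof.
move=> c0; have [l l0 h] := coord_ofcoord c0; exists l => // x.
by rewrite /Phi /act phiE; apply: cphi_scale.
Qed.

End Seminorms.

(** * Topology of the compactified apartment *)

Lemma finite_pos_lb (R : realType) (n : nat) (F : 'I_n -> R) :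
  (forall i, 0 < F i) -> exists2 e : R, 0 < e & forall i, e <= F i.
Proof.
move=> F0; exists (\big[Num.min/1]_i F i); last by move=> i; apply: bigmin_le.
by apply: lt_bigmin.
Qed.

Lemma finite_ub (R : realType) (n : nat) (F : 'I_n -> R) :
  exists2 C : R, 0 < C & forall i, F i <= C.
Proof.
exists (\big[Num.max/1]_i F i); first exact: lt_le_trans ltr01 (bigmax_ge_id _ _ _ _).
by move=> i; apply: le_bigmax.
Qed.

Lemma norm_mean_le (R : realType) (n : nat) (t : 'I_n -> R) (d : R) :
  0 <= d -> (forall i, `|t i| <= d) ->
  `|(\sum_(i in [set: 'I_n]) t i) / #|[set: 'I_n]|%:R| <= d.
Proof.
move=> d0 td; rewrite normrM normfV normr_nat.
have [->|n0] := eqVneq (#|[set: 'I_n]|%:R : R) 0; first by rewrite invr0 mulr0.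
rewrite ler_pdivrMr ?lt0r ?n0 ?ler0n //; apply: le_trans (ler_norm_sum _ _ _) _.
apply: le_trans (ler_sum _ (fun i _ => td i)) _.
by rewrite sumr_const -[d *+ _]mulr_natr.
Qed.

Section Apartment.
Variables (R : realType) (K : fieldType) (v : K -> int) (q n : nat).
Hypothesis hK : nonarch_local_field K v q.
Local Notation abs := (absK R K v q).
Local Notation b := (q%:R : R).
Local Notation coord := (@coord R q n).
Implicit Types (p : pt R n) (I J : {set 'I_n}) (z d : 'I_n -> R) (U : ('I_n -> R) -> Prop).

(** Continuity at 0 suffices: exponents add, so weights are compared through their ratios. *)
Lemma powRb_cts (e : R) : 0 < e ->
  exists2 d : R, 0 < d & forall s, `|s| < d -> `|b `^ s - 1| < e.
Proof.
move=> e0; have e1 : 0 < 1 + e by lra.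
exists (ln (1 + e) / ln b).
  by rewrite divr_gt0 ?(ln_b_gt0 R hK) // ln_gt0; lra.
move=> s; rewrite ltr_norml => /andP[]; rewrite -(ltr_powRb hK) => h1.
rewrite -(ltr_powRb hK) => h2; move: h1 h2; rewrite powRN (powR_ln_div hK) // => h1 h2.
rewrite ltr_norml; apply/andP; split; last by lra.
apply: le_lt_trans (_ : (1 + e)^-1 - 1 < _); last by rewrite ltrD2r.
rewrite lerBrDr -[X in _ <= X]div1r ler_pdivlMr //; nra.
Qed.

Lemma powRb_inv_cts (d : R) : 0 < d ->
  exists2 e : R, 0 < e <= 1 & forall s, `|b `^ s - 1| < e -> `|s| < d.
Proof.
move=> d0; have bd : 1 < b `^ d by rewrite -[X in X < _](powRr0 b) (ltr_powRb hK).
have bd0 : 0 < b `^ d by apply: lt_trans bd.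
have bN : b `^ (- d) * b `^ d = 1 by rewrite -(powRDb hK) addNr powRr0.
have bN0 : 0 < b `^ (- d) by exact: (powR_gt0b hK).
(* The lower side is the tighter one, since [b^d - 1 >= 1 - b^(-d)]. *)
exists (1 - b `^ (- d)); first by apply/andP; split; nra.
move=> s; rewrite ltr_norml => /andP[h1 h2].
by rewrite ltr_norml; apply/andP; split; rewrite -(ltr_powRb hK); nra.
Qed.

(** [s_J] only restricts a representative to [J] and recenters it, so the part in [A] and the
    boundary strata obey one formula, with [J] allowed to be everything. *)
Lemma GammaP I U p : Gamma R n I U p <->
  exists J z d, [/\ I \subset J, U z, forall i, 0 <= d i,
    forall i, i \in I -> d i = 0 & p = (J, normz R n J (fun i => z i + d i))].
Proof.
split.
  case=> [[p1 [z [d [Uz d0 dI p2]]]]|[J [IJ JT [w [z [d [Uz d0 dI ->]]] ->]]]].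
    exists [set: 'I_n], z, d; split => //.
    by rewrite -p2 -p1; case: p p1 p2.
  exists J, z, d; split=> //; congr pair; rewrite [X in normz _ _ J X = _]/normz.
  apply: (@normz_shift _ _ _ _ _
    (- ((\sum_(j in [set: 'I_n]) (z j + d j)) / #|[set: 'I_n]|%:R))) => i _.
  by rewrite inE.
move=> [J [z [d [IJ Uz d0 dI ->]]]].
have [->|JT] := eqVneq J [set: 'I_n]; first by left; split=> //; exists z, d.
right; exists J; split=> //; first by rewrite properT.
exists (normz R n [set: 'I_n] (fun i => z i + d i)); first by exists z, d.
congr pair; symmetry; apply: (@normz_shift _ _ _ _ _
    (- ((\sum_(j in [set: 'I_n]) (z j + d j)) / #|[set: 'I_n]|%:R))) => i _.
by rewrite normz_in ?inE.
Qed.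

(** Here [Delta_I] is zero: open sets of [A] become one more case of the other base sets, and a
    single kind remains to be handled. *)
Lemma GammaT U : (forall z, U z -> inA R n z) ->
  Gamma R n [set: 'I_n] U = fun p => p.1 = [set: 'I_n] /\ U p.2.
Proof.
move=> UA; apply/funext => p; apply/propext; split.
  move=> /GammaP[J [z [d [TJ Uz d0 dI ->]]]] /=.
  have -> : J = [set: 'I_n] by apply/eqP; rewrite finset.eqEsubset finset.subsetT.
  split=> //; suff -> : (fun i => z i + d i) = z by rewrite normz_id //; exact: UA.
  by apply/funext => i; rewrite dI ?addr0 ?inE.
case: p => J z /= [-> Uz]; apply/GammaP; exists [set: 'I_n], z, (fun=> 0); split=> //.
congr pair; rewrite -[LHS](@normz_id _ _ [set: 'I_n]); last exact: UA.
by congr normz; apply/funext => i; rewrite addr0.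
Qed.

Lemma base_Gamma I U : I != finset.set0 -> A_open R n U -> A_bounded R n U ->
  Abar_base R n (Gamma R n I U).
Proof.
move=> I0 Uo Ub; have [IT|IT] := eqVneq I [set: 'I_n].
  by left; exists U => //; rewrite IT GammaT //; case: Uo.
by right; exists I, U; split=> //; rewrite properT.
Qed.

Lemma baseP (B : pt R n -> Prop) : Abar_base R n B ->
  exists I U, A_open R n U /\ B = Gamma R n I U.
Proof.
case=> [[U Uo ->]|[I [U [_ _ Uo _ ->]]]]; last by exists I, U.
by exists [set: 'I_n], U; rewrite GammaT //; case: Uo.
Qed.

(** In [Gamma I U] the weights on [I] are those of [U] up to a factor, while [Delta_I] only raises
    exponents off [I] and so shrinks the other weights. A small box [U] far out in the direction
    [Delta_I] gives the neighbourhood. *)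
Lemma coord_nbhs_open p (e : R) : inAbar R n p -> 0 < e ->
  exists O, [/\ Abar_open R n O, O p & forall p', O p' -> inAbar R n p' /\
    exists2 l : R, 0 < l & forall i, `|l * coord p' i - coord p i| < e].
Proof.
case: p => I x pA e0; have [/= I0 x0 sx] := pA.
have [C C0 hC] := finite_ub (coord (I, x)).
have [dl dl0 hdl] := powRb_cts (divr_gt0 e0 C0).
(* Exponents off [I] will be at least [M - dl], up to the shift [k], so this [M] keeps those weights
   at most [e / 2]. *)
have [M hM] : exists M, b `^ (- M) * b `^ dl <= e / 2.
  exists (- (ln (e / 2 / b `^ dl) / ln b)); rewrite opprK (powR_ln_div hK); last first.
    by rewrite !divr_gt0 ?(powR_gt0b hK) //; lra.
  by rewrite divfK // gt_eqF // (powR_gt0b hK).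
pose L0 i := if i \in I then x i else M.
pose L := normz R n [set: 'I_n] L0.
pose k := (\sum_(j in [set: 'I_n]) L0 j) / #|[set: 'I_n]|%:R.
have LE i : L i = L0 i - k by rewrite /L normz_in ?inE.
have TA : [set: 'I_n] != finset.set0.
  by case/set0Pn: I0 => i _; apply/set0Pn; exists i; rewrite inE.
pose U z := inA R n z /\ forall i, `|z i - L i| < dl.
have Uo : A_open R n U.
  split=> [z []//|z [zA zL]].
  have [|e' e'0 he'] := @finite_pos_lb R n (fun i => dl - `|z i - L i|).
    by move=> i; rewrite subr_gt0.
  exists e' => // z' z'A z'z; split=> // i.
  have -> : z' i - L i = (z' i - z i) + (z i - L i) by ring.
  apply: le_lt_trans (ler_normD _ _) _.
  by have := z'z i; have := he' i; lra.
have Ub : A_bounded R n U.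
  have [D _ hD] := finite_ub (fun i => `|L i|).
  exists (dl + D) => z [_ zL] i; rewrite -[z i](subrK (L i)).
  by apply: le_trans (ler_normD _ _) _; rewrite lerD // ltW.
exists (Gamma R n I U); split.
- by move=> p' Gp'; exists (Gamma R n I U); split=> //; exact: base_Gamma.
- apply/GammaP; exists I, L, (fun=> 0); split=> //.
    split; first exact: inAI_normz.
    by move=> i; rewrite subrr normr0.
  congr pair; rewrite -[LHS](@normz_id _ _ I) //.
  by apply: (@normz_shift _ _ _ _ _ k) => i iI; rewrite addr0 LE /L0 iI subrK.
move=> p' /GammaP[J [z [d [IJ [zA zL] d0 dI ->]]]]; split.
  apply: inAI_normz; case/set0Pn: I0 => i iI.
  by apply/set0Pn; exists i; exact: (fintype.subsetP IJ).
have [l l0 hl] := coord_normz hK J (fun i => z i + d i).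
exists (b `^ (- k) / l); first by rewrite divr_gt0 ?(powR_gt0b hK).
move=> i; rewrite hl mulrA divfK ?gt_eqF //.
have zk s : b `^ (- k) * b `^ (- s) = b `^ (- (s + k)).
  by rewrite -(powRDb hK) opprD addrC.
have [iI|iI] := boolP (i \in I).
  rewrite (fintype.subsetP IJ i iI) coord_in //= dI // addr0 zk.
  have -> : - (z i + k) = - x i + - (z i - L i) by rewrite LE /L0 iI; ring.
  rewrite (powRDb hK) -{2}[b `^ (- x i)]mulr1 -mulrBr normrM.
  have hs : `|b `^ (- (z i - L i)) - 1| < e / C by apply: hdl; rewrite normrN.
  rewrite ger0_norm ?powR_ge0 //.
  have := hC i; rewrite coord_in //= => hCi.
  apply: le_lt_trans (ler_wpM2r _ hCi) _; first exact: normr_ge0.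
  by rewrite mulrC -ltr_pdivlMr.
rewrite /coord /= (negbTE iI) subr0; case: ifP => iJ; last by rewrite mulr0 normr0.
rewrite zk ger0_norm ?powR_ge0 //.
have hs : - (z i + d i + k) <= - M + dl.
  have := zL i; rewrite LE /L0 (negbTE iI) ltr_norml => /andP[h _].
  by have := d0 i; lra.
apply: le_lt_trans (_ : b `^ (- M + dl) < _); first by rewrite (ler_powRb hK).
by rewrite (powRDb hK); apply: le_lt_trans hM _; lra.
Qed.

(** A point with nearby weights stays in [Gamma]: the change of its exponents on [I] is absorbed by
    moving [z] within [U], and its exponents on [J] off [I], being large, by enlarging [d]. *)
Lemma open_coord_nbhs (W : pt R n -> Prop) p : Abar_open R n W -> W p -> inAbar R n p ->
  exists2 e : R, 0 < e & forall p' (l : R), inAbar R n p' -> 0 < l ->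
    (forall i, `|l * coord p' i - coord p i| < e) -> W p'.
Proof.
move=> Wo Wp pA; have [B [/baseP[I' [U [Uo ->]]] Bp BW]] := Wo p Wp.
move: Bp => /GammaP[I [z [d [I'I Uz d0 dI' pE]]]].
have [UA /(_ z Uz)[eU eU0 hU]] := Uo.
have eU2 : 0 < eU / 3 by lra.
have [eta /andP[eta0 eta1] heta] := powRb_inv_cts eU2.
have [l0 l00 hl0] := coord_normz hK I (fun i => z i + d i).
rewrite -pE in hl0.
have p1 : p.1 = I by rewrite pE.
(* On [I] a relative error below [eta] moves exponents by less than [eU / 3]; off [I] the weight
   stays below that of [z], so the exponent exceeds [z i]. *)
have [|e e0 he] := @finite_pos_lb R n
    (fun i => if i \in I then eta * coord p i else l0 * b `^ (- z i)).
  move=> i; case: ifP => iI; first by rewrite mulr_gt0 // (coord_gt0 hK) // p1.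
  by rewrite mulr_gt0 // (powR_gt0b hK).
exists e => // -[J y] l pA' lgt hl; apply: BW; apply/GammaP.
have IJ : I \subset J.
  apply/fintype.subsetP => i iI; rewrite -[J]/((J, y).1) -(coord_gt0 hK).
  have := hl i; have := he i; rewrite iI => h1; rewrite ltr_norml => /andP[h2 _].
  rewrite -(pmulr_rgt0 _ lgt).
  have h3 : eta * coord p i <= coord p i by rewrite ler_piMl // coord_ge0.
  lra.
pose s := ln (l / l0) / ln b.
have bs : b `^ s = l / l0 by rewrite (powR_ln_div hK) // divr_gt0.
pose r i := y i - s.
have hr i : i \in J -> l * coord (J, y) i = l0 * b `^ (- r i).
  move=> iJ; rewrite coord_in //= /r opprB (powRDb hK) bs.
  by rewrite mulrA [l0 * _]mulrC divfK // gt_eqF.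
pose t i := if i \in I then r i - (z i + d i) else 0.
have ht i : `|t i| < eU / 3.
  rewrite /t; case: ifP => iI; last by rewrite normr0.
  rewrite distrC; apply: heta.
  have := hl i; rewrite hr ?(fintype.subsetP IJ) // => h1.
  have h2 := lt_le_trans h1 (he i); move: h2; rewrite iI hl0 iI.
  have -> : b `^ (- r i) = b `^ (- (z i + d i)) * b `^ (z i + d i - r i).
    by rewrite -(powRDb hK); congr (_ `^ _); ring.
  set X := b `^ (- (z i + d i)); set Y := b `^ _.
  have X0 : 0 < l0 * X by rewrite mulr_gt0 // (powR_gt0b hK).
  have -> : l0 * (X * Y) - l0 * X = l0 * X * (Y - 1) by ring.
  by rewrite normrM gtr0_norm // [eta * _]mulrC ltr_pM2l.
pose m := (\sum_(i in [set: 'I_n]) t i) / #|[set: 'I_n]|%:R.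
have hm : `|m| <= eU / 3 by apply: norm_mean_le => [|i]; [exact: ltW | exact/ltW/ht].
have zA := UA _ Uz.
(* [m] brings the moved point back to sum zero, and [t] and [m] together stay below [eU]. With the
   new [d] the total is [r - m] on all of [J], a shift of [y]. *)
exists J, (fun i => z i + t i - m),
  (fun i => if i \in I then d i else if i \in J then r i - z i else 0); split.
- exact: fintype.subset_trans I'I IJ.
- apply: hU => [|i]; last first.
    have -> : z i + t i - m - z i = t i - m by ring.
    apply: le_lt_trans (ler_normB _ _) _; have := ht i; lra.
  have -> : (fun i => z i + t i - m) = normz R n [set: 'I_n] (fun i => z i + t i).
    apply/funext => i; rewrite normz_in ?inE // big_split /=.
    by case: zA => _ _ ->; rewrite add0r.
  by apply: inAI_normz; case: zA.
- move=> i; case: ifP => // iI; case: ifP => // iJ; rewrite subr_ge0 ltW //.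
  have := hl i; have := he i; rewrite iI hr // {1}/coord p1 iI subr0.
  rewrite ger0_norm; last by rewrite mulr_ge0 ?powR_ge0 // ltW.
  move=> h1 h2; have := lt_le_trans h2 h1.
  by rewrite ltr_pM2l // (ltr_powRb hK) ltrN2.
- by move=> i iI'; rewrite (fintype.subsetP I'I) // dI'.
congr pair; rewrite -[LHS](@normz_id _ _ J) //.
apply: (@normz_shift _ _ _ _ _ (s + m)) => i iJ; rewrite iJ /t /r.
by case: ifP => iI; ring.
Qed.

(** Inside [A] the half-space is this inequality of weights, which is homogeneous and closed; a
    boundary point satisfying it is approached from [A] by making its zero weights slightly
    positive. *)
Lemma closure_halfspace p i j (t : R) : inAbar R n p -> i != j ->
  Abar_closure R n (fun z => inA R n z /\ - t <= z i - z j) p <->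
  coord p i <= b `^ t * coord p j.
Proof.
move=> pA ij; have bt0 : 0 < b `^ t by exact: (powR_gt0b hK).
have AE z : inA R n z -> (- t <= z i - z j) =
    (coord ([set: 'I_n], z) i <= b `^ t * coord ([set: 'I_n], z) j).
  move=> zA; rewrite !coord_in ?inE //= -(powRDb hK) (ler_powRb hK).
  by apply/idP/idP; lra.
split.
  move=> cl; rewrite leNgt; apply/negP => h.
  pose e := (coord p i - b `^ t * coord p j) / (2 * (1 + b `^ t)).
  have e0 : 0 < e by rewrite divr_gt0 ?subr_gt0 //; lra.
  have [Q [Qo Qp hQ]] := coord_nbhs_open pA e0.
  have [z [[zA zt] /hQ[_ [l l0 hl]]]] := cl Q Qo Qp.
  move: zt; rewrite AE // -(ler_pM2l l0) mulrCA.
  have := hl i; have := hl j; rewrite !ltr_norml => /andP[_ h1] /andP[h2 _] h3.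
  have h4 : b `^ t * (l * coord ([set: 'I_n], z) j) < b `^ t * (coord p j + e).
    by rewrite ltr_pM2l //; lra.
  have : e * (1 + b `^ t) = (coord p i - b `^ t * coord p j) / 2.
    by rewrite /e invfM mulrA divfK // gt_eqF //; lra.
  lra.
move=> h W Wo Wp; have [e e0 he] := open_coord_nbhs Wo Wp pA.
(* Zero weights become [e / 2]; the one at [i], if zero, is also capped so that the inequality with
   [j] survives. *)
pose c1 k := if k \in p.1 then coord p k else e / 2.
pose c k := if (k == i) && (i \notin p.1) then Num.min (e / 2) (b `^ t * c1 j) else c1 k.
have e2 : 0 < e / 2 by lra.
have c1gt k : 0 < c1 k by rewrite /c1; case: ifP => // kp; rewrite (coord_gt0 hK).
have cgt k : 0 < c k.
  by rewrite /c; case: ifP => // _; rewrite lt_min e2 mulr_gt0.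
have hc k : `|c k - coord p k| < e.
  have off : k \notin p.1 -> coord p k = 0 by rewrite /coord => /negbTE ->.
  have half x : 0 < x -> x <= e / 2 -> `|x - 0| < e.
    by move=> x0 xe; rewrite subr0 gtr0_norm //; lra.
  have hc1 : `|c1 k - coord p k| < e.
    rewrite /c1; case: ifP => [|/negbT /off ->]; first by rewrite subrr normr0.
    exact: half.
  rewrite /c; case: ifP => // /andP[/eqP ki ip]; rewrite -ki in ip; rewrite (off ip).
  by apply: half; rewrite ?lt_min ?e2 ?mulr_gt0 // ge_min lexx.
have [l l0 hl] := coord_ofcoord hK (fun k => ltW (cgt k)).
have cA := ofcoord_inAbar q (ex_intro _ i (cgt i)).
have cT : ofcoord q c = ([set: 'I_n], (ofcoord q c).2).
  rewrite [LHS]surjective_pairing; congr pair; apply/setP => k.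
  by rewrite -(coord_gt0 hK) hl inE mulr_gt0.
exists (ofcoord q c).2; have cA' := cA; rewrite cT in cA'; split.
  split; first exact: cA'.
  rewrite AE // -cT !hl mulrCA ler_pM2l //.
  have -> : c j = c1 j by rewrite /c eq_sym (negbTE ij).
  rewrite /c eqxx /=; case: ifP => [_|/negbFE ip]; first by rewrite ge_min lexx orbT.
  rewrite {1}/c1 ip (le_trans h) // ler_pM2l // /c1; case: ifP => // jp.
  by rewrite /coord jp ltW.
rewrite -cT; apply: (he _ l^-1) => //; first by rewrite invr_gt0.
by move=> k; rewrite hl mulKf ?gt_eqF.
Qed.

(** In weights, [fx p i j] is the base-[q] logarithm of [coord p i / coord p j]: minus infinity if
    [coord p i] is 0, plus infinity if only [coord p j] is. *)
Lemma fx_leP p i j (x : K) : inAbar R n p -> i != j -> x != 0 ->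
  (fx R n p i j <= ((v x)%:~R)%:E)%E <-> abs x * coord p i <= coord p j.
Proof.
move=> pA ij x0; set V := (v x)%:~R : R.
have -> : (abs x * coord p i <= coord p j) = (coord p i <= b `^ V * coord p j).
  rewrite absK_powR // -/V mulrC powRN ler_pdivrMr ?(powR_gt0b hK) //.
  by rewrite mulrC.
split; last first.
  move=> h; apply: ereal_inf_lbound; exists V; split => //.
  exact/closure_halfspace.
apply: contraPP => /negP; rewrite -ltNge => h.
(* A bound strictly above [V] is needed, since an infimum may equal [V] without being attained. If
   [coord p j] is 0, no [t] qualifies and [V + 1] serves. *)
suff [t0 Vt0 ht0] : exists2 t0, V < t0 & forall t, coord p i <= b `^ t * coord p j -> t0 <= t.
  apply/negP; rewrite -ltNge; apply: (@lt_le_trans _ _ t0%:E); first by rewrite lte_fin.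
  apply: le_ereal_inf_tmp => _ [t [-> cl]]; rewrite lee_fin ht0 //.
  exact/closure_halfspace.
have ci : 0 < coord p i.
  by apply: le_lt_trans h; apply: mulr_ge0; [exact: powR_ge0 | exact: coord_ge0].
have [j0|jn0] := eqVneq (coord p j) 0.
  by exists (V + 1); [lra | move=> t; rewrite j0 mulr0 leNgt ci].
have cj : 0 < coord p j by rewrite lt_neqAle eq_sym jn0 coord_ge0.
exists (ln (coord p i / coord p j) / ln b).
  by rewrite -(ltr_powRb hK) (powR_ln_div hK) ?divr_gt0 // ltr_pdivlMr.
by move=> t; rewrite -ler_pdivrMr // -(ler_powRb hK) (powR_ln_div hK) ?divr_gt0.
Qed.

End Apartment.

(** * Stabilizers, monomial matrices and injectivity *)

Section WellDefinedInjective.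
Variables (R : realType) (K : fieldType) (v : K -> int) (q n : nat).
Hypothesis hK : nonarch_local_field K v q.
Local Notation abs := (absK R K v q).
Local Notation b := (q%:R : R).
Local Notation coord := (@coord R q n).
Local Notation phi := (phi R K v q n).
Implicit Types (x y : pt R n) (i j k l : 'I_n) (g h m : 'M[K]_n) (w : 'cV[K]_n) (u : K).

(** * Transvections and the groups [U_x] *)

Definition transvection i j u : 'M[K]_n := 1%:M + u *: delta_mx i j.

Lemma transvectionE i j u w l :
  (transvection i j u *m w) l ord0 = w l ord0 + (if l == i then u * w j ord0 else 0).
Proof.
rewrite mulmxDl mul1mx -scalemxAl !mxE; congr (_ + _).
rewrite (bigD1 j) //= big1 ?addr0 => [|c cj]; last first.
  by rewrite mxE (negbTE cj) andbF mul0r.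
by rewrite mxE eqxx andbT; case: eqVneq; rewrite ?mul1r // mul0r mulr0.
Qed.

Lemma transvectionK i j u : i != j -> transvection i j u *m transvection i j (- u) = 1%:M.
Proof.
move=> ij; rewrite /transvection mulmxDl mul1mx mulmxDr mulmx1.
rewrite -scalemxAl -scalemxAr mul_delta_mx_cond eq_sym (negbTE ij) mulr0n !scaler0 addr0.
by rewrite scaleNr addrNK.
Qed.

Lemma transvection_unit i j u : i != j -> transvection i j u \in unitmx.
Proof. by move=> ij; case: (mulmx1_unit (transvectionK u ij)). Qed.

Lemma UijP x i j m : inAbar R n x -> i != j -> Uij R K v n x i j m <->
  exists2 u, m = transvection i j u & abs u * coord x i <= coord x j.
Proof.
move=> xA ij; split=> [[u [hu ->]]|[u -> hu]]; exists u => //.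
  have [->|u0] := eqVneq u 0; first by rewrite absK0 mul0r coord_ge0.
  by case: hu => [/eqP|/(fx_leP hK xA ij u0)//]; rewrite (negbTE u0).
split=> //; have [->|u0] := eqVneq u 0; first by left.
by right; apply/(fx_leP hK xA ij u0).
Qed.

Lemma phi_transvection_le x i j u w : abs u * coord x i <= coord x j ->
  phi x (transvection i j u *m w) <= phi x w.
Proof.
move=> hu; rewrite !phiE; apply: cphi_le => [|l]; first exact: cphi_ge0.
rewrite transvectionE; have [->|li] := eqVneq l i; last by rewrite addr0 cphi_ge.
have := absKD R hK (w i ord0) (u * w j ord0); rewrite le_max => /orP[] h.
  apply: (@le_trans _ _ (abs (w i ord0) * coord x i)); last exact: cphi_ge.
  by rewrite ler_wpM2r // coord_ge0.
apply: (@le_trans _ _ (abs (w j ord0) * coord x j)); last exact: cphi_ge.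
apply: (@le_trans _ _ (abs (u * w j ord0) * coord x i)).
  by rewrite ler_wpM2r // coord_ge0.
by rewrite (absKM R hK) mulrAC [abs (w _ _) * _]mulrC ler_wpM2r // (absK_ge0 R hK).
Qed.

Lemma Uij_stab x i j m : inAbar R n x -> i != j -> Uij R K v n x i j m ->
  m \in unitmx /\ forall w, phi x (m *m w) = phi x w.
Proof.
move=> xA ij /(UijP _ xA ij)[u -> hu]; split; first exact: transvection_unit.
move=> w; apply/eqP; rewrite eq_le phi_transvection_le //=.
rewrite -{1}[w]mul1mx -(transvectionK (- u) ij) opprK -mulmxA.
by apply: phi_transvection_le; rewrite (absKN R hK).
Qed.

Lemma Ux_stab x g : inAbar R n x -> Ux R K v n x g ->
  g \in unitmx /\ forall w, phi x (g *m w) = phi x w.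
Proof.
move=> xA [s [hs ->]]; elim: s hs => [|m s IH] hs /=.
  by split=> [|w]; rewrite ?unitmx1 ?mul1mx.
have [|sU sphi] := IH; first by move=> m' m's; apply: hs; rewrite inE m's orbT.
have [mU mphi] : m \in unitmx /\ forall w, phi x (m *m w) = phi x w.
  have [i [j [ij [/Uij_stab|/Uij_stab]]]] := hs m (mem_head _ _); first exact.
  move=> /(_ xA ij)[]; rewrite unitmx_inv => mU mphi; split=> // w.
  by rewrite -mphi mulKmx.
by split=> [|w]; rewrite ?unitmx_mul ?mU // -mulmxA mphi sphi.
Qed.

Lemma Ux1 x : Ux R K v n x 1%:M.
Proof. by exists [::]; split. Qed.

Lemma UxM x g h : Ux R K v n x g -> Ux R K v n x h -> Ux R K v n x (g *m h).
Proof.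
move=> [s [hs ->]] [t [ht ->]]; exists (s ++ t); split.
  by move=> m; rewrite mem_cat => /orP[/hs|/ht].
elim: s {hs} => [|a s IH] /=; first by rewrite mul1mx.
by rewrite -mulmxA IH.
Qed.

Lemma Ux_transvection x i j u : inAbar R n x -> i != j ->
  abs u * coord x i <= coord x j -> Ux R K v n x (transvection i j u).
Proof.
move=> xA ij hu; exists [:: transvection i j u]; split; last by rewrite /= mulmx1.
move=> m; rewrite inE => /eqP ->; exists i, j; split=> //; left.
by apply/(UijP _ xA ij); exists u.
Qed.

(** Off-diagonal part of a Gauss step: [1 + colop i c] adds [c l] times row [i] to each other row
    [l]. Its square is zero, so inversion only changes the sign. Transposed, it adapts a basis in
    [orthogonal_basis]. *)
Definition colop i (c : 'I_n -> K) : 'M[K]_n :=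
  \sum_(l | l != i) c l *: delta_mx l i.

Lemma colopE i c m l j : (colop i c *m m) l j = if l != i then c l * m i j else 0.
Proof.
rewrite /colop mulmx_suml summxE; have E l' : (c l' *: delta_mx l' i *m m) l j =
    if l == l' then c l * m i j else 0.
  rewrite -scalemxAl !mxE (bigD1 i) //= big1 => [|a ai]; last first.
    by rewrite mxE (negbTE ai) andbF mul0r.
  by rewrite addr0 mxE eqxx andbT; case: eqVneq => [->|_]; rewrite ?mul1r // mul0r mulr0.
case: ifP => [li|/negbFE/eqP li].
  rewrite (bigD1 l) //= E eqxx big1 ?addr0 // => l' /andP[_ l'l].
  by rewrite E eq_sym (negbTE l'l).
by rewrite big1 // => l' l'i; rewrite E li eq_sym (negbTE l'i).
Qed.

Lemma colopK i c : (1%:M + colop i c) *m (1%:M - colop i c) = 1%:M.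
Proof.
rewrite mulmxDl mul1mx; have -> : colop i c *m (1%:M - colop i c) = colop i c.
  apply/matrixP => l j; rewrite mulmxBr mulmx1 mxE [X in _ + X]mxE colopE.
  have -> : colop i c i j = 0 by rewrite -[colop i c]mulmx1 colopE eqxx.
  by rewrite mulr0 if_same subr0.
by rewrite addrNK.
Qed.

Lemma Ux_colop x i c : inAbar R n x ->
  (forall l, l != i -> abs (c l) * coord x l <= coord x i) ->
  Ux R K v n x (1%:M + colop i c).
Proof.
move=> xA hc; rewrite /colop -big_filter.
(* Induction over a list of indices other than [i]: the products [E_li E_ji] vanish because
   [j != i], so transvections multiply by adding their off-diagonal parts. *)
have : all (fun l => l != i) [seq l <- index_enum 'I_n | l != i] by exact: filter_all.
elim: [seq _ <- _ | _] => [|l s IH] /=; first by rewrite big_nil addr0 => _; exact: Ux1.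
move=> /andP[li hs]; rewrite big_cons.
have -> : 1%:M + (c l *: delta_mx l i + \sum_(j <- s) c j *: delta_mx j i) =
    transvection l i (c l) *m (1%:M + \sum_(j <- s) c j *: delta_mx j i) :> 'M[K]_n.
  rewrite /transvection mulmxDl mul1mx mulmxDr mulmx1 mulmx_sumr.
  rewrite [X in _ + (_ + X)]big1_seq ?addr0; first by rewrite addrA addrAC.
  move=> j /andP[_ js]; have ji := allP hs _ js.
  by rewrite -scalemxAl -scalemxAr mul_delta_mx_cond eq_sym (negbTE ji) mulr0n !scaler0.
by apply: UxM (IH hs); apply: Ux_transvection => //; exact: hc.
Qed.

Lemma monomialP g : monomial K n g <-> exists s t : 'I_n -> 'I_n,
  [/\ cancel s t, cancel t s & forall k i, (g k i != 0) = (k == s i)].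
Proof.
split=> [[hr hc]|[s [t [st ts hs]]]]; last first.
  split=> k; apply/eqP/cards1P.
    by exists (t k); apply/setP => i; rewrite !inE hs -(can2_eq ts st) eq_sym.
  by exists (s k); apply/setP => i; rewrite !inE hs.
have /choice[f hf] i : exists k, forall l, (g l i != 0) = (l == k).
  have /eqP/cards1P[k hk] := hc i; exists k => l.
  by move/setP/(_ l): hk; rewrite !inE.
have fI : injective f.
  move=> i j fij; have /eqP/cards1P[a ha] := hr (f i).
  have ai l : g (f i) l != 0 -> l = a.
    by move/setP/(_ l): ha; rewrite !inE => -> /eqP.
  by rewrite (ai i) ?hf // (ai j) // hf fij.
by have [f' ff' f'f] := injF_bij fI; exists f, f'.
Qed.

(** * Monomial matrices acting on weights *)

Section Monomial.
Variables (g : 'M[K]_n) (s t : 'I_n -> 'I_n).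
Hypotheses (st : cancel s t) (ts : cancel t s).
Hypothesis gs : forall k i, (g k i != 0) = (k == s i).

Lemma monomial_out k i : k != s i -> g k i = 0.
Proof. by rewrite -gs negbK => /eqP. Qed.

Lemma monomial_pos i : pos K n g (s i) = i.
Proof.
rewrite /pos; case: pickP => [j|/(_ i)] /=; last by rewrite gs eqxx.
by rewrite gs => /eqP/(can_inj st).
Qed.

Definition monomial_inv : 'M[K]_n :=
  \matrix_(i, k) (if k == s i then (g k i)^-1 else 0).

Lemma monomial_invK : monomial_inv *m g = 1%:M.
Proof.
apply/matrixP => i j; rewrite !mxE (bigD1 (s i)) //= big1 ?addr0 => [|k ki]; last first.
  by rewrite mxE (negbTE ki) mul0r.
rewrite mxE eqxx; case: eqVneq => [->|ij]; first by rewrite mulVf // gs eqxx.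
by rewrite (@monomial_out (s i) j) ?mulr0 // (inj_eq (can_inj st)).
Qed.

Lemma monomial_unit : g \in unitmx.
Proof. by case: (mulmx1_unit monomial_invK). Qed.

Lemma monomial_invmx : invmx g = monomial_inv.
Proof. by rewrite -[RHS](mulmxK monomial_unit) monomial_invK mul1mx. Qed.

Lemma monomial_invmxE w i : (invmx g *m w) i ord0 = (g (s i) i)^-1 * w (s i) ord0.
Proof.
rewrite monomial_invmx mxE (bigD1 (s i)) //= big1 ?addr0 => [|k ki]; last first.
  by rewrite mxE (negbTE ki) mul0r.
by rewrite mxE eqxx.
Qed.

(** Translating an exponent by [- v d] multiplies the weight by [q^(v d) = |d|^(-1)], the factor
    that composing with the inverse matrix produces. *)
Lemma nu_phi p : inAbar R n p -> inAbar R n (nu R K v n g p) /\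
  sn_equiv R K n (act R K n g (phi p)) (phi (nu R K v n g p)).
Proof.
move=> pA; split.
  apply: inAI_normz; case: pA => /set0Pn[i iI] _ _; apply/set0Pn; exists (s i).
  by rewrite inE monomial_pos.
have [l l0 hl] := coord_normz hK [set k | pos K n g k \in p.1]
  (fun k => p.2 (pos K n g k) - (v (g k (pos K n g k)))%:~R).
have hc i : coord (nu R K v n g p) (s i) = l * (abs (g (s i) i)^-1 * coord p i).
  have g0 : g (s i) i != 0 by rewrite gs.
  rewrite hl inE monomial_pos (absKV R hK) absK_powR // -powRN opprK /coord.
  by case: ifP => _; rewrite ?mulr0 // opprB (powRDb hK).
exists l => // w; rewrite /act !phiE; apply/eqP; rewrite eq_le; apply/andP; split.
  apply: cphi_le => [|k]; first by rewrite mulr_ge0 ?cphi_ge0 // ltW.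
  rewrite -(ts k) hc mulrCA ler_pM2l // mulrA [abs (w _ _) * _]mulrC.
  by rewrite -(absKM R hK) -monomial_invmxE cphi_ge.
rewrite mulrC -ler_pdivlMr //; apply: cphi_le => [|i].
  by rewrite divr_ge0 ?cphi_ge0 // ltW.
rewrite ler_pdivlMr // monomial_invmxE (absKM R hK).
rewrite [X in X <= _](_ : _ = abs (w (s i) ord0) * coord (nu R K v n g p) (s i)).
  exact: cphi_ge.
by rewrite hc; ring.
Qed.

End Monomial.

(** The relation reads [h m = g t r] with [t] in [N_x] and [r] in [U_x]: both fix the class of
    [phi x], and [m] carries it to that of [phi y]. *)
Lemma Phi_Xrel (a c : 'M[K]_n * pt R n) : Xrel R K v n a c ->
  sn_equiv R K n (Phi R K v q n a) (Phi R K v q n c).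
Proof.
case: a c => [g x] [h y] /= [/= gU xA hU yA [m [mm mx [t [r [[tm tx] rU E]]]]]].
have [s1 [s1' [s1K s1K' ms]]] := (monomialP m).1 mm; have mU := monomial_unit s1K ms.
have [s2 [s2' [s2K s2K' ts]]] := (monomialP t).1 tm; have tU := monomial_unit s2K ts.
have [rUn rphi] := Ux_stab xA rU.
have [_ hm] := nu_phi s1K s1K' ms xA; have [_ ht] := nu_phi s2K s2K' ts xA.
rewrite mx in hm; rewrite tx in ht.
have e : h *m m = g *m (t *m r) by rewrite -E -mulmxA mulKVmx.
have actr : act R K n r (phi x) = phi x.
  by apply/funext => w; rewrite /act -[LHS]rphi mulKVmx.
rewrite /Phi /=; apply: (sn_equiv_trans (g := act R K n g (act R K n t (phi x)))).
  exact/sn_equiv_act/sn_equiv_sym.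
have -> : act R K n g (act R K n t (phi x)) = act R K n h (act R K n m (phi x)).
  rewrite -[in LHS]actr -(act_mul _ tU rUn) -(act_mul _ gU) ?unitmx_mul ?tU //.
  by rewrite -e act_mul.
exact: sn_equiv_act.
Qed.

(** * Reduction to a monomial matrix *)

Section Elimination.
Variables (x y : pt R n) (k : 'M[K]_n) (C : R).
Hypotheses (xA : inAbar R n x) (kU : k \in unitmx) (C0 : 0 < C).
Hypothesis xy : forall w, phi x (k *m w) = C * phi y w.

(** [r] gives the pivot rows; its values from [d] on are junk, so injectivity is asked below [d]
    only. *)
Definition reduced (d : nat) (k' : 'M[K]_n) (r : 'I_n -> 'I_n) :=
  (forall j, (j < d)%N -> forall l, (k' l j != 0) = (l == r j)) /\
  (forall j j', (j < d)%N -> (j' < d)%N -> r j = r j' -> j = j').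

(* Subtracting from the [j]-th vector its components along the columns already reduced does not decrease the norm, because the standard basis is orthogonal for [phi y]; so the maximum of the [j]-th column is attained outside the rows already used. *)
Lemma pivot (k' p : 'M[K]_n) (r : 'I_n -> 'I_n) j : Ux R K v n x p -> k = p *m k' ->
  reduced j k' r -> exists i, [/\ forall j', (j' < j)%N -> r j' != i, k' i j != 0 &
    forall l, abs (k' l j) * coord x l <= abs (k' i j) * coord x i].
Proof.
move=> pU kE [kr rI]; have [pUn pphi] := Ux_stab xA pU.
have k'U : k' \in unitmx by move: kU; rewrite kE unitmx_mul => /andP[].
have xy' w : phi x (k' *m w) = C * phi y w by rewrite -xy kE -mulmxA pphi.
(* [k' w] is zero in the pivot rows used so far and equals column [j] in the free ones, so any
   nonzero entry of it sits in a free row. *)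
pose w : 'cV[K]_n := \col_a (if a == j then 1 else
  if (a < j)%N then - (k' (r a) j / k' (r a) a) else 0).
have wE i : (k' *m w) i ord0 = k' i j + \sum_(a : 'I_n | (a < j)%N) - (k' (r a) j / k' (r a) a) * k' i a.
  rewrite mxE (bigD1 j) //= mxE eqxx mulr1; congr (_ + _).
  rewrite [RHS]big_mkcond [RHS](bigD1 j) //= ltnn add0r.
  apply: eq_bigr => a aj; rewrite mxE (negbTE aj).
  by case: ifP => _; rewrite ?mulr0 // mulrC.
have wfree i : (forall a : 'I_n, (a < j)%N -> r a != i) -> (k' *m w) i ord0 = k' i j.
  move=> hi; rewrite wE big1 ?addr0 // => a aj.
  have /negbFE/eqP -> : (k' i a != 0) = false by rewrite kr // eq_sym (negbTE (hi a aj)).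
  by rewrite mulr0.
have wused (a : 'I_n) : (a < j)%N -> (k' *m w) (r a) ord0 = 0.
  move=> aj; rewrite wE (bigD1 a) //= big1 ?addr0 => [|c /andP[cj ca]].
    by rewrite mulNr divfK ?subrr // kr ?eqxx.
  have /negbFE/eqP -> : (k' (r a) c != 0) = false.
    by rewrite kr //; apply/negbTE/eqP => /(rI _ _ aj cj) e; rewrite e eqxx in ca.
  by rewrite mulr0.
have free i : (k' *m w) i ord0 != 0 -> forall a : 'I_n, (a < j)%N -> r a != i.
  by move=> h a aj; apply/eqP => e; rewrite -e wused // eqxx in h.
have hcol l : abs (k' l j) * coord x l <= C * coord y j.
  have := xy' (delta_mx j ord0); rewrite -colE !phiE (cphi_delta hK) => [<-|]; last exact: coord_ge0.
  by have := cphi_ge v q (coord x) (col j k') l; rewrite mxE.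
have wj : C * coord y j <= phi x (k' *m w).
  rewrite xy' ler_pM2l // phiE; have := cphi_ge v q (coord y) w j.
  by rewrite mxE eqxx (absK1 R hK) mul1r.
have [yj|yj] := ltP 0 (coord y j).
  have Cy : 0 < C * coord y j by exact: mulr_gt0.
  have [i hi] : exists i, C * coord y j <= abs ((k' *m w) i ord0) * coord x i.
    apply: contrapT => /forallNP h.
    have : phi x (k' *m w) < C * coord y j.
      rewrite phiE; apply: bigmax_lt => // i _.
      by rewrite ltNge; apply/negP; exact: h.
    by rewrite ltNge wj.
  have ki0 : (k' *m w) i ord0 != 0.
    by apply/eqP => e; move: hi; rewrite e absK0 mul0r leNgt Cy.
  have fi := free i ki0; rewrite wfree // in ki0 hi.
  by exists i; split=> // l; exact: le_trans (hcol l) hi.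
(* If [coord y j] is 0, the whole column has weighted norm 0 and any nonzero entry in a free row
   will do; invertibility of [k'] supplies one. *)
have [i ki0] : exists i, (k' *m w) i ord0 != 0.
  apply: contrapT => /forallNP h.
  have kw0 : k' *m w = 0 by apply/colP => i; rewrite [RHS]mxE; apply/eqP/negPn/negP/h.
  have : w j ord0 = 0 by rewrite -(mulKmx k'U w) kw0 mulmx0 mxE.
  by rewrite mxE eqxx => /eqP; rewrite oner_eq0.
have fi := free i ki0; rewrite wfree // in ki0.
exists i; split=> // l; apply: le_trans (hcol l) _.
have -> : coord y j = 0 by apply/eqP; rewrite eq_le yj coord_ge0.
by rewrite mulr0 mulr_ge0 ?(absK_ge0 R hK) // coord_ge0.
Qed.

(** Maximality of the pivot is the bound that [Ux_colop] asks of the multipliers, so the row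
    operations stay in [U_x]. The pivot row is zero in the earlier columns, which therefore
    survive. *)
Lemma elimination (d : nat) : (d <= n)%N -> exists (p k' : 'M[K]_n) r,
  [/\ Ux R K v n x p, k = p *m k' & reduced d k' r].
Proof.
elim: d => [|d IH] dn.
  by exists 1%:M, k, id; split; [exact: Ux1 | rewrite mul1mx | split].
have [p [k' [r [pU kE red]]]] := IH (ltnW dn).
pose j := Ordinal dn; have [i [fi ki0 hi]] := @pivot k' p r j pU kE red.
have [kr rI] := red.
pose c l := k' l j / k' i j.
exists (p *m (1%:M + colop i c)), ((1%:M - colop i c) *m k').
exists (fun a => if a == j then i else r a); split.
- apply: UxM => //; apply: Ux_colop => // l li.
  rewrite (absKM R hK) (absKV R hK) mulrAC ler_pdivrMr ?(absK_gt0 R hK) //.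
  by rewrite [coord x i * _]mulrC hi.
- by rewrite -mulmxA (mulmxA (1%:M + _)) colopK mul1mx.
have entry l a : ((1%:M - colop i c) *m k') l a =
    k' l a - (if l != i then c l * k' i a else 0).
  by rewrite mulmxBl mul1mx mxE [X in _ + X]mxE colopE.
have lt_neq (a : 'I_n) : (a < d.+1)%N -> a != j -> (a < d)%N.
  by rewrite ltnS leq_eqVlt => /orP[/eqP e|//]; rewrite -val_eqE /= e eqxx.
split.
  move=> a am l; rewrite entry; case: (eqVneq a j) => [->|aj].
    case: (eqVneq l i) => [->|li]; first by rewrite subr0 ki0.
    by rewrite /c divfK // subrr eqxx.
  have {}am := lt_neq a am aj.
  have /negbFE/eqP -> : (k' i a != 0) = false by rewrite kr // eq_sym (negbTE (fi a am)).
  by rewrite mulr0 if_same subr0 kr.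
move=> a a' am am'; case: (eqVneq a j) => [->|aj]; case: (eqVneq a' j) => [->|a'j] //.
- by move=> e; have := fi a' (lt_neq _ am' a'j); rewrite e eqxx.
- by move=> e; have := fi a (lt_neq _ am aj); rewrite e eqxx.
- by apply: rI; exact: lt_neq.
Qed.

Lemma monomial_reduction : exists p k' : 'M[K]_n, [/\ Ux R K v n x p, k = p *m k' & monomial K n k'].
Proof.
have [p [k' [r [pU kE [kr rI]]]]] := elimination (leqnn n).
exists p, k'; split=> //; apply/monomialP.
have rinj : injective r by move=> j j'; apply: rI.
by have [r' rr' r'r] := injF_bij rinj; exists r, r'; split=> // l j; rewrite kr.
Qed.

End Elimination.

Lemma Phi_inj (a c : 'M[K]_n * pt R n) :
  GLn K n a.1 -> inAbar R n a.2 -> GLn K n c.1 -> inAbar R n c.2 ->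
  sn_equiv R K n (Phi R K v q n a) (Phi R K v q n c) -> Xrel R K v n a c.
Proof.
case: a c => [g x] [h y] /= gU xA hU yA /sn_equiv_sym[C C0 E].
pose k := invmx g *m h.
have kU : k \in unitmx by rewrite unitmx_mul unitmx_inv gU.
have xyE w : phi x (k *m w) = C * phi y w.
  by have := E (h *m w); rewrite /Phi /act /= mulKmx // mulmxA.
have [p [k' [pU kE k'm]]] := monomial_reduction xA kU C0 xyE.
have [s [t [st ts ks]]] := (monomialP k').1 k'm; have k'U := monomial_unit st ks.
have kt i l : (invmx k' i l != 0) = (i == t l).
  rewrite (monomial_invmx st ks) mxE [l == _]eq_sym (can2_eq st ts).
  by case: (eqVneq i (t l)) => [->|_]; rewrite ?eqxx // invr_eq0 ks ts eqxx.
have [nuA nuE] := nu_phi ts st kt xA; have [pUn pphi] := Ux_stab xA pU.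
(* With [m] the inverse of [k'], the element [invmx g *m h *m m] is [p] itself, and its factor in
   [N_x] can be the identity. *)
split=> //; exists (invmx k'); split=> /=.
- by apply/monomialP; exists t, s.
- apply: (phi_inj hK) => //; apply: (sn_equiv_trans (sn_equiv_sym nuE)).
  apply: sn_equiv_sym; exists C => // w.
  by rewrite /act invmxK -xyE kE -mulmxA pphi.
exists 1%:M, p; split=> //; last by rewrite mul1mx -/k kE mulmxK.
have m1 i l : ((1%:M : 'M[K]_n) i l != 0) = (i == l).
  by rewrite mxE; case: (i == l); rewrite ?mulr1n ?mulr0n ?oner_eq0 ?eqxx.
split; first by apply/monomialP; exists id, id.
have [n1A n1E] := nu_phi (fun=> erefl) (fun=> erefl) m1 xA; apply: (phi_inj hK) => //.
apply: (sn_equiv_trans (sn_equiv_sym n1E)); exists 1 => // w.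
by rewrite /act invmx1 !mul1mx mul1r.
Qed.

End WellDefinedInjective.

(** * Splitting bases *)

Section Splitting.
Variables (R : realType) (K : fieldType) (v : K -> int) (q n : nat).
Hypothesis hK : nonarch_local_field K v q.
Local Notation abs := (absK R K v q).
Local Notation presem := (@presem R K v q n).
Local Notation cphi := (@cphi R K v q n).
Local Notation e_ i := (delta_mx i ord0 : 'cV[K]_n).
Implicit Types (c : 'I_n -> K) (y : 'cV[K]_n) (f : 'cV[K]_n -> R) (i j l : 'I_n).

Definition lin_form c y : K := \sum_j c j * y j ord0.

Lemma lin_formB c y y' : lin_form c (y - y') = lin_form c y - lin_form c y'.
Proof. by rewrite -sumrB; apply: eq_bigr => j _; rewrite !mxE mulrBr. Qed.

Lemma lin_formZ c a y : lin_form c (a *: y) = a * lin_form c y.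
Proof. by rewrite mulr_sumr; apply: eq_bigr => j _; rewrite mxE mulrCA. Qed.

Lemma lin_form_delta c i : lin_form c (e_ i) = c i.
Proof.
rewrite /lin_form (bigD1 i) //= mxE !eqxx mulr1 big1 ?addr0 // => j ji.
by rewrite mxE (negbTE ji) mulr0.
Qed.

Lemma lin_form_set c j a y :
  lin_form (fun l => if l == j then a else c l) y =
  a * y j ord0 + lin_form c (y - y j ord0 *: e_ j).
Proof.
rewrite /lin_form (bigD1 j) //= eqxx; congr (_ + _).
rewrite [RHS](bigD1 j) //= !mxE !eqxx mulr1 subrr mulr0 add0r.
by apply: eq_bigr => l lj; rewrite !mxE (negbTE lj) mulr0 subr0.
Qed.

(* Hahn-Banach over a spherically complete field, one coordinate at a time. *)
Lemma norming_functional f (D : {set 'I_n}) i : presem f -> i \notin D ->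
  0 < f (e_ i) -> (forall y j, j \in D -> abs (y j ord0) * f (e_ j) <= f y) ->
  exists c, [/\ c i = 1, forall j, j \in D -> c j = 0 &
    forall y, abs (lin_form c y) * f (e_ i) <= f y].
Proof.
move=> hf iD fi0 hD.
pose supp (d : nat) y := forall j, (d <= j)%N -> j \notin D -> j != i -> y j ord0 = 0.
suff H d : (d <= n)%N -> exists c, [/\ c i = 1, forall j, j \in D -> c j = 0 &
    forall y, supp d y -> abs (lin_form c y) * f (e_ i) <= f y].
  have [c [ci cD hc]] := H n (leqnn n); exists c; split=> // y; apply: hc => j.
  by rewrite leqNgt ltn_ord.
elim: d => [_|d IH dn].
  (* On the span of [e_i] and the vectors of [D] the form is the [i]-th coordinate: by [hD] each
     [D]-component of [y] has norm at most [f y], hence so does what is left. *)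
  exists (fun j => (j == i)%:R); rewrite eqxx; split=> // [j jD|y sy].
    by case: eqVneq => // ji; rewrite ji (negbTE iD) in jD.
  have -> : lin_form (fun j => (j == i)%:R) y = y i ord0.
    rewrite /lin_form (bigD1 i) //= eqxx mul1r big1 ?addr0 // => j ji.
    by rewrite (negbTE ji) mul0r.
  rewrite -(presemZ hf).
  have -> : y i ord0 *: e_ i = y - \sum_(j in D) y j ord0 *: e_ j.
    apply/eqP; rewrite eq_sym subr_eq [X in X == _]col_sum_delta (bigID (mem D)) /= addrC.
    rewrite (bigD1 i) //= big1 ?addr0 // => j /andP[jD ji].
    by rewrite sy // scale0r.
  apply: (presemB_le hK hf) => //; apply: (presem_sum hf) => [|j jD].
    exact: presem_ge0 hf _.
  by rewrite (presemZ hf) hD.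
have [c [ci cD hc]] := IH (ltnW dn); pose j := Ordinal dn.
have [jDi|/norP[jD ji]] := boolP ((j \in D) || (j == i)).
  exists c; split=> // y sy; apply: hc => l; rewrite leq_eqVlt => /predU1P[dl|dl]; last exact: sy.
  move=> lD li; have e : l = j by apply: val_inj.
  by move: jDi; rewrite -e (negbTE lD) (negbTE li).
(* A value [a] at [j] is admissible when [|a + c(w)| f(e_i) <= f(e_j + w)] for all [w] treated
   before. These are balls, and the bound known on [w' - w] keeps their centres close enough to
   meet. *)
pose T := {w : 'cV[K]_n | supp d w}.
have s0 : supp d 0 by move=> l _ _ _; rewrite mxE.
have [||a ha] := @balls_meet R K v q hK T (exist _ _ s0)
    (fun w => - lin_form c (sval w)) (fun w => f (e_ j + sval w) / f (e_ i)).
- by move=> w; rewrite divr_ge0 ?(presem_ge0 hf).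
- move=> [w sw] [w' sw'] /=; rewrite opprK addrC -lin_formB.
  have sB : supp d (w' - w) by move=> l dl lD li; rewrite !mxE sw ?sw' ?subrr.
  rewrite -[X in X <= _](mulfK (lt0r_neq0 fi0)) -maxr_pMl ?invr_ge0 ?(ltW fi0) //.
  rewrite ler_pM2r ?invr_gt0 //; apply: le_trans (hc _ sB) _.
  have -> : w' - w = (e_ j + w') - (e_ j + w) by rewrite opprD addrACA subrr add0r.
  by apply: (presemB_le hK hf); rewrite le_max lexx ?orbT.
exists (fun l => if l == j then a else c l); split.
- by rewrite eq_sym (negbTE ji).
- move=> l lD; case: (eqVneq l j) => [lj|_]; last exact: cD.
  by rewrite -lj lD in jD.
move=> y sy; rewrite lin_form_set; set w := y - _.
have sw : supp d w.
  move=> l; rewrite leq_eqVlt => /predU1P[dl|dl] lD li.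
    have -> : l = j by apply: val_inj.
    by rewrite !mxE !eqxx mulr1 subrr.
  have lj : l != j by rewrite -val_eqE /= gtn_eqF.
  by rewrite !mxE (negbTE lj) mulr0 subr0 sy.
have [yj0|yj] := eqVneq (y j ord0) 0.
  rewrite yj0 mulr0 add0r; have -> : y = w by rewrite /w yj0 scale0r subr0.
  exact: hc.
have swj : supp d ((y j ord0)^-1 *: w).
  by move=> l dl lD li; rewrite mxE sw ?mulr0.
have -> : a * y j ord0 + lin_form c w =
    y j ord0 * (a - - lin_form c ((y j ord0)^-1 *: w)).
  by rewrite opprK lin_formZ mulrDr mulVKf // mulrC.
have yE : y = y j ord0 *: (e_ j + (y j ord0)^-1 *: w).
  by rewrite scalerDr scalerA divff // scale1r /w addrC subrK.
rewrite [X in _ <= f X]yE (presemZ hf) (absKM R hK) -mulrA ler_wpM2l ?(absK_ge0 R hK) //.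
by rewrite -ler_pdivlMr //; exact: (ha (exist _ _ swj)).
Qed.

Definition integral_mx (k : 'M[K]_n) := forall i j, abs (k i j) <= 1.

Lemma integral_mx1 : integral_mx 1%:M.
Proof.
by move=> i j; rewrite mxE; case: (i == j); rewrite ?mulr1n ?mulr0n ?(absK1 R hK) ?absK0.
Qed.

Lemma integral_mxM k m : integral_mx k -> integral_mx m -> integral_mx (k *m m).
Proof.
move=> hk hm i j; rewrite mxE; apply: (absK_sum hK) => // a _.
by rewrite (absKM R hK) mulr_ile1 ?(absK_ge0 R hK).
Qed.

Lemma integral_mxD k m : integral_mx k -> integral_mx m -> integral_mx (k + m).
Proof. by move=> hk hm i j; rewrite mxE (absKD_le hK). Qed.

Lemma integral_mxN k : integral_mx k -> integral_mx (- k).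
Proof. by move=> hk i j; rewrite mxE (absKN R hK). Qed.

Lemma integral_colop i c : (forall j, abs (c j) <= 1) -> integral_mx (colop i c)^T.
Proof.
move=> hc a j; rewrite mxE -[colop i c]mulmx1 colopE; case: ifP => _; last by rewrite absK0.
by rewrite (absKM R hK) mulr_ile1 ?(absK_ge0 R hK) // integral_mx1.
Qed.

Lemma colop_trE i c y l : ((1%:M - (colop i c)^T) *m y) l ord0 =
  y l ord0 - (if l == i then \sum_(j | j != i) c j * y j ord0 else 0).
Proof.
rewrite mulmxBl mul1mx mxE [X in _ + X]mxE; congr (_ - _).
rewrite mxE [in RHS]big_mkcond /=.
transitivity (\sum_j if l == i then (if j != i then c j * y j ord0 else 0) else 0).
  apply: eq_bigr => j _; rewrite mxE -[colop i c]mulmx1 colopE mxE [i == l]eq_sym.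
  by case: (l == i); case: (j != i); rewrite ?mulr1n ?mulr0n ?mulr1 ?mulr0 ?mul0r.
by case: (l == i); rewrite // big1.
Qed.

(* Split off a basis vector on which [f] is maximal among the remaining ones: a norming functional there takes integral values on the lattice, so the change of basis stays in [GL_n] of the valuation ring. *)
Lemma orthogonal_basis f : presem f -> exists k k' : 'M[K]_n,
  [/\ k *m k' = 1%:M, integral_mx k, integral_mx k' &
   forall y, f (k *m y) = cphi (fun i => f (k *m e_ i)) y].
Proof.
move=> hf.
suff H d : (d <= n)%N -> exists (D : {set 'I_n}) (k k' : 'M[K]_n),
    [/\ #|D| = d, k *m k' = 1%:M, integral_mx k, integral_mx k' &
     forall y i, i \in D -> abs (y i ord0) * f (k *m e_ i) <= f (k *m y)].
  have [D [k [k' [cD kk' kO k'O hk]]]] := H n (leqnn n); exists k, k'; split=> // y.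
  have DT : D = [set: 'I_n].
    by apply/eqP; rewrite finset.eqEcard finset.subsetT cardsT card_ord cD leqnn.
  have hfk := presem_comp k hf; apply/eqP; rewrite eq_le (presem_le_cphi hfk) /=.
  by apply: cphi_le => [|i]; [exact: (presem_ge0 hf) | apply: hk; rewrite DT inE].
elim: d => [_|d IH dn].
  exists finset.set0, 1%:M, 1%:M; split; rewrite ?cards0 ?mulmx1 //; try exact: integral_mx1.
  by move=> y i; rewrite inE.
have [D [k [k' [cD kk' kO k'O hk]]]] := IH (ltnW dn).
have [i0 i0D] : exists i0, i0 \notin D.
  apply/existsP; rewrite -negb_forall; apply/negP => /forallP h.
  have DT : D = [set: 'I_n] by apply/setP => i; rewrite inE h.
  by move: dn; rewrite -cD DT cardsT card_ord ltnn.
pose g y := f (k *m y); have hg : presem g := presem_comp k hf.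
have [i iD imax] : exists2 i, i \notin D & forall j, j \notin D -> g (e_ j) <= g (e_ i).
  by case: (@arg_maxP _ _ _ i0 (fun i => i \notin D) (fun i => g (e_ i)) i0D) => i iD h; exists i.
have [c [ci cD0 hc c1]] : exists c, [/\ c i = 1, forall j, j \in D -> c j = 0,
    forall y, abs (lin_form c y) * g (e_ i) <= g y & forall j, abs (c j) <= 1].
  (* If the maximum is 0, the bound on the form is trivial and the [i]-th coordinate serves. *)
  have [gi0|gi0] := leP (g (e_ i)) 0.
    have {}gi0 : g (e_ i) = 0 by apply/eqP; rewrite eq_le gi0 (presem_ge0 hg).
    exists (fun j => (j == i)%:R); rewrite eqxx; split=> // [j jD|y|j].
    - by case: eqVneq => // ji; rewrite ji (negbTE iD) in jD.
    - by rewrite gi0 mulr0 (presem_ge0 hg).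
    - by case: eqVneq; rewrite ?(absK1 R hK) ?absK0.
  have [c [ci cD0 hc]] := norming_functional hg iD gi0 hk.
  exists c; split=> // j; have [jD|jD] := boolP (j \in D); first by rewrite cD0 // absK0.
  have := hc (e_ j); rewrite lin_form_delta => h.
  by rewrite -(ler_pM2r gi0) mul1r (le_trans h) // imax.
(* [1 - N] turns [e_j] into [e_j - c_j e_i] for [j != i], a vector killed by the form [c]; [e_i] and
   the vectors of [D] do not move. *)
have NO := integral_colop i c1; set N := (colop i c)^T in NO.
have NK : (1%:M - N) *m (1%:M + N) = 1%:M.
  by have := congr1 trmx (colopK i c); rewrite trmx_mul linearB linearD /= trmx1.
have NE l : c l = 0 \/ l = i -> (1%:M - N) *m e_ l = e_ l.
  move=> hl; apply/colP => a; rewrite colop_trE; case: (a == i); last by rewrite subr0.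
  rewrite big1 ?subr0 // => j ji; rewrite mxE eqxx andbT.
  case: eqVneq => [jl|_]; last by rewrite mulr0.
  by case: hl => [e|li]; [rewrite jl e mul0r | rewrite jl li eqxx in ji].
exists (i |: D), (k *m (1%:M - N)), ((1%:M + N) *m k'); split.
- by rewrite cardsU1 iD cD.
- by rewrite -mulmxA (mulmxA (1%:M - N)) NK mul1mx.
- by apply: integral_mxM => //; apply: integral_mxD (integral_mxN _) => //; exact: integral_mx1.
- by apply: integral_mxM => //; apply: integral_mxD => //; exact: integral_mx1.
move=> y l lD; rewrite -!mulmxA.
have hl : c l = 0 \/ l = i by move: lD; rewrite !inE => /predU1P[->|/cD0 ->]; [right | left].
rewrite NE //; set z := (1%:M - N) *m y.
have [li|li] := eqVneq l i; last first.
  have -> : y l ord0 = z l ord0 by rewrite colop_trE (negbTE li) subr0.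
  by apply: hk; move: lD; rewrite !inE (negbTE li).
have -> : y l ord0 = lin_form c z.
  rewrite /lin_form (bigD1 i) //= ci mul1r colop_trE eqxx li -[LHS]addr0 -addrA; congr (_ + _).
  have -> : \sum_(j | j != i) c j * z j ord0 = \sum_(j | j != i) c j * y j ord0.
    by apply: eq_bigr => j ji; rewrite colop_trE (negbTE ji) subr0.
  by rewrite addNr.
by rewrite li; exact: hc.
Qed.

Lemma act_cphi_pos (c : 'I_n -> R) (k : 'M[K]_n) : (forall i, 0 <= c i) ->
  seminorm R K v q n (act R K n k (cphi c)) -> exists i, 0 < c i.
Proof.
move=> c0 [_ [x xn0] _ _]; apply: contrapT => /forallNP h; move/eqP: xn0; apply.
apply/eqP; rewrite eq_le cphi_ge0 andbT; apply: cphi_le => // i.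
have -> : c i = 0 by apply/eqP; rewrite eq_le c0 andbT leNgt; apply/negP/h.
by rewrite mulr0.
Qed.

Lemma Phi_surj gam : seminorm R K v q n gam -> exists a : 'M[K]_n * pt R n,
  [/\ GLn K n a.1, inAbar R n a.2 & sn_equiv R K n gam (Phi R K v q n a)].
Proof.
move=> hgam; have hf := seminorm_presem hgam.
have [k [k' [kk' _ _ hk]]] := orthogonal_basis hf.
have [kU _] := mulmx1_unit kk'.
pose c i := gam (k *m e_ i); have c0 i : 0 <= c i by exact: (presem_ge0 hf).
have gamE : gam = act R K n k (cphi c).
  by apply/funext => y; rewrite /act -hk mulKVmx.
exists (k, ofcoord q c); split=> //=; last by rewrite [X in sn_equiv _ _ _ X]gamE; exact: sn_equiv_cphi.
by apply: ofcoord_inAbar; apply: (act_cphi_pos (k := k)) => //; rewrite -gamE.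
Qed.

End Splitting.

(** * Continuity and openness *)

Section Topology.
Variables (R : realType) (K : fieldType) (v : K -> int) (q n : nat).
Hypothesis hK : nonarch_local_field K v q.
Local Notation abs := (absK R K v q).
Local Notation coord := (@coord R q n).
Local Notation cphi := (@cphi R K v q n).
Local Notation Phi := (Phi R K v q n).
Local Notation seminorm := (seminorm R K v q n).
Local Notation sn_equiv := (sn_equiv R K n).
Local Notation e_ i := (delta_mx i ord0 : 'cV[K]_n).
Implicit Types (c : 'I_n -> R) (g h k : 'M[K]_n) (y w : 'cV[K]_n) (x p : pt R n).

Lemma absK_dist (s t : K) : `|abs s - abs t| <= abs (s - t).
Proof.
have := absKD R hK (s - t) t; have := absKD R hK (t - s) s.
have -> : abs (t - s) = abs (s - t) by rewrite -(absKN R hK) opprB.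
rewrite !subrK !le_max ler_norml.
have := absK_ge0 R hK s; have := absK_ge0 R hK t; have := absK_ge0 R hK (s - t).
move=> h1 h2 h3 /orP[]h4 /orP[]h5; apply/andP; split; lra.
Qed.

Lemma absK_mulmx_le k y (s t : R) i : 0 <= s -> 0 <= t ->
  (forall i j, abs (k i j) <= s) -> (forall j, abs (y j ord0) <= t) ->
  abs ((k *m y) i ord0) <= s * t.
Proof.
move=> s0 t0 hk hy; rewrite mxE; apply: (absK_sum hK) => [|j _]; first exact: mulr_ge0.
by rewrite (absKM R hK) ler_pM ?(absK_ge0 R hK).
Qed.

Lemma absK_col_ub y : exists2 C : R, 0 < C & forall i, abs (y i ord0) <= C.
Proof. exact: (finite_ub (fun i => abs (y i ord0))). Qed.

Lemma absK_mx_ub k : exists2 C : R, 0 < C & forall i j, abs (k i j) <= C.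
Proof.
have /choice[C hC] i : exists C : R, forall j, abs (k i j) <= C.
  by have [C _ hC] := finite_ub (fun j => abs (k i j)); exists C.
have [D D0 hD] := finite_ub C; exists D => // i j.
exact: le_trans (hC i j) (hD i).
Qed.

(* [invmx h *m w - invmx g *m w = E *m (invmx h *m w)] with [E = invmx g *m (g - h)] contracting, so [invmx h *m w] is no larger than [invmx g *m w]. *)
Lemma invmx_cts g w (e : R) : g \in unitmx -> 0 < e ->
  exists2 d : R, 0 < d & forall h, h \in unitmx ->
    (forall i j, abs (h i j - g i j) < d) ->
    forall i, abs ((invmx h *m w) i ord0 - (invmx g *m w) i ord0) < e.
Proof.
move=> gU e0; have [A A0 hA] := absK_mx_ub (invmx g).
have [Y Y0 hY] := absK_col_ub (invmx g *m w).
pose r := Num.min (1 / 2) (e / (2 * Y)) : R.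
have r0 : 0 < r by rewrite lt_min !divr_gt0 ?mulr_gt0 //; lra.
have r1 : r < 1 by rewrite gt_min; apply/orP; left; lra.
have rY : r * Y < e.
  apply: (@le_lt_trans _ _ (e / 2)); last by lra.
  have -> : e / 2 = e / (2 * Y) * Y by rewrite invfM mulrA divfK // gt_eqF.
  by rewrite ler_pM2r // ge_min lexx orbT.
exists (r / A); first exact: divr_gt0.
move=> h hU hg; pose y := invmx h *m w; pose E := invmx g *m (g - h).
have yE : y - invmx g *m w = E *m y.
  rewrite /E -mulmxA mulmxBl mulmxBr mulKmx //; congr (_ - _).
  by rewrite /y mulKVmx.
have hE i j : abs (E i j) <= r.
  rewrite mxE; apply: (absK_sum hK) => [|a _]; first exact: ltW.
  rewrite (absKM R hK) -[X in _ <= X](divfK (lt0r_neq0 A0)) mulrC.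
  rewrite ler_pM ?(absK_ge0 R hK) // !mxE -(absKN R hK) opprB ltW //.
pose S := cphi (fun=> 1) y; have S0 : 0 <= S by exact: cphi_ge0.
have hS i : abs (y i ord0) <= S.
  by rewrite -[X in X <= _]mulr1; exact: (cphi_ge v q (fun=> 1) y i).
have hE' i : abs ((E *m y) i ord0) <= r * S by apply: absK_mulmx_le => //; exact: ltW.
have SY : S <= Y.
  have : S <= Num.max Y (r * S).
    apply: cphi_le => [|i]; first by rewrite le_max (ltW Y0).
    rewrite mulr1; have -> : y = invmx g *m w + E *m y by rewrite -yE addrC subrK.
    rewrite mxE; apply: (absKD_le hK); rewrite le_max; first by rewrite hY.
    by rewrite hE' orbT.
  rewrite le_max => /orP[//|h1]; have S_le0 : S <= 0 by nra.
  exact: le_trans S_le0 (ltW Y0).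
move=> i; have -> : (invmx h *m w) i ord0 - (invmx g *m w) i ord0 = (E *m y) i ord0.
  by rewrite -yE !mxE.
by apply: le_lt_trans rY; apply: le_trans (hE' i) _; rewrite ler_pM2l.
Qed.

Lemma act_cphi_cts g c w (e : R) : g \in unitmx -> (forall i, 0 <= c i) -> 0 < e ->
  exists2 d : R, 0 < d & forall h c', h \in unitmx -> (forall i, 0 <= c' i) ->
    (forall i j, abs (h i j - g i j) < d) -> (forall i, `|c' i - c i| < d) ->
    `|act R K n h (cphi c') w - act R K n g (cphi c) w| < e.
Proof.
move=> gU c0 e0; have [Y Y0 hY] := absK_col_ub (invmx g *m w).
have [C C0 hC] := finite_ub c.
have r0 : 0 < e / 4 / (C + 1) by rewrite !divr_gt0 //; lra.
have [d1 d10 hd1] := invmx_cts w gU r0.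
(* The bound 1 keeps [c'] below [C + 1]; the variations of entries and weights then contribute at
   most [e / 4] each. *)
exists (Num.min d1 (Num.min 1 (e / 4 / Y))).
  by rewrite !lt_min d10 ltr01 !divr_gt0 //; lra.
move=> h c' hU c'0 hg hc; apply: (@le_lt_trans _ _ (e / 2)); last by lra.
apply: cphi_dist => //; first by lra.
move=> i; set s := (invmx h *m w) i ord0; set t := (invmx g *m w) i ord0.
have hst : `|abs s - abs t| <= e / 4 / (C + 1).
  apply: le_trans (absK_dist _ _) (ltW _); apply: hd1 => // a b.
  by apply: lt_le_trans (hg a b) _; rewrite ge_min lexx.
have hci : `|c' i - c i| <= 1 /\ `|c' i - c i| <= e / 4 / Y.
  by move: (ltW (hc i)); rewrite !le_min => /and3P[].
have c'C : `|c' i| <= C + 1.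
  rewrite ger0_norm //; case: hci => + _; rewrite ler_norml => /andP[_ h1].
  by have := hC i; lra.
have -> : abs s * c' i - abs t * c i = (abs s - abs t) * c' i + abs t * (c' i - c i) by ring.
apply: le_trans (ler_normD _ _) _; rewrite !normrM.
have h1 : `|abs s - abs t| * `|c' i| <= e / 4.
  have -> : e / 4 = e / 4 / (C + 1) * (C + 1) by rewrite divfK // gt_eqF //; lra.
  by rewrite ler_pM.
have h2 : `|abs t| * `|c' i - c i| <= e / 4.
  have -> : e / 4 = Y * (e / 4 / Y) by rewrite [RHS]mulrC divfK // gt_eqF.
  by rewrite ler_pM //; [rewrite ger0_norm ?(absK_ge0 R hK) ?hY | case: hci].
lra.
Qed.

Lemma act_cphi_cts_seq g c (F : seq 'cV[K]_n) (e : R) :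
  g \in unitmx -> (forall i, 0 <= c i) -> 0 < e ->
  exists2 d : R, 0 < d & forall h c', h \in unitmx -> (forall i, 0 <= c' i) ->
    (forall i j, abs (h i j - g i j) < d) -> (forall i, `|c' i - c i| < d) ->
    forall w, w \in F -> `|act R K n h (cphi c') w - act R K n g (cphi c) w| < e.
Proof.
move=> gU c0 e0; elim: F => [|w F [d d0 IH]]; first by exists 1.
have [d' d'0 hd'] := act_cphi_cts w gU c0 e0.
exists (Num.min d d'); first by rewrite lt_min d0.
move=> h c' hU c'0 hg hc w'; rewrite inE => /predU1P[->|w'F].
  by apply: hd' => // [i j|i]; [have := hg i j|have := hc i]; rewrite lt_min => /andP[].
by apply: IH => // [i j|i]; [have := hg i j|have := hc i]; rewrite lt_min => /andP[].
Qed.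

Lemma Phi_cts (O : ('cV[K]_n -> R) -> Prop) : S_open R K v q n O ->
  XA_open R K v q n (fun a => [/\ GLn K n a.1, inAbar R n a.2 & O (Phi a)]).
Proof.
move=> [[Osn Oo] Osat] [g x] /= [gU xA Og]; split=> //.
have [F [e e0 hF]] := Oo _ Og.
have [d d0 hd] := act_cphi_cts_seq F gU (coord_ge0 q x) e0.
have [V2 [V2o V2x hV2]] := coord_nbhs_open hK xA d0.
exists (fun h => h \in unitmx /\ forall i j, abs (h i j - g i j) < d), V2; split=> //.
- move=> h [hU hg]; split=> //; exists d => // h' h'U h'h; split=> // i j.
  have -> : h' i j - g i j = (h' i j - h i j) + (h i j - g i j) by ring.
  by apply: le_lt_trans (absKD R hK _ _) _; rewrite gt_max h'h hg.
- by split=> // i j; rewrite subrr absK0.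
move=> h p [hU hg] /hV2[pA [l l0 hl]]; split=> //.
have c'0 i : 0 <= l * coord p i by rewrite mulr_ge0 ?coord_ge0 // ltW.
(* [V2] controls weights only up to the factor [l], so the estimate is made for this rescaled
   representative and brought back by saturation of [O]. *)
pose f := act R K n h (cphi (fun i => l * coord p i)).
have fPhi : sn_equiv (Phi (h, p)) f.
  exists l => // w; rewrite /f /act /Defs.Phi /act /= phiE.
  exact: cphi_scale.
have sPhi : seminorm (Phi (h, p)) by exact: (Phi_seminorm hK).
have sf : seminorm f.
  apply: presem_seminorm; first exact: (presem_comp (invmx h) (presem_cphi hK c'0)).
  case: fPhi => k k0 kE; case: sPhi => _ [w wn0] _ _; exists w.
  by rewrite kE mulf_neq0 // gt_eqF.
apply: (Osat f) => //; first exact: sn_equiv_sym.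
apply: hF => // w wF; have := hd h _ hU c'0 hg hl w wF.
by rewrite [Phi _ w]/Defs.Phi [in act _ _ _ g (phi _ _ _ _ _ _) w]/act /= phiE.
Qed.

Local Open Scope classical_set_scope.

(* The lattice data [(k, f (k e_i))] of a splitting basis live in a compact set; their limit along an ultrafilter of seminorms converging to [gam] splits [gam]. *)
Section Limit.
Variables (G : set_system ('cV[K]_n -> R)) (gam : 'cV[K]_n -> R).
Hypotheses (UG : UltraFilter G) (Gsemi : G [set f | presem v q f])
  (Gcvg : forall w e, 0 < e -> G [set f | `|f w - gam w| < e]).

Lemma split_limit (k k' : ('cV[K]_n -> R) -> 'M[K]_n) :
  (forall f, presem v q f -> [/\ k f *m k' f = 1%:M, integral_mx R v q (k f),
     integral_mx R v q (k' f) &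
     forall y, f (k f *m y) = cphi (fun i => f (k f *m e_ i)) y]) ->
  exists k0 c0, [/\ k0 \in unitmx, forall i, 0 <= c0 i, gam = act R K n k0 (cphi c0) &
    forall e, 0 < e -> G [set f | (forall i j, abs (k f i j - k0 i j) < e) /\
      forall i, `|f (k f *m e_ i) - c0 i| < e]].
Proof.
move=> hk.
have mx_limit (m : ('cV[K]_n -> R) -> 'M[K]_n) :
    (forall f, presem v q f -> integral_mx R v q (m f)) ->
    exists m0 : 'M[K]_n, forall e, 0 < e -> G [set f | forall i j, abs (m f i j - m0 i j) < e].
  move=> hm; have /choice[L hL] (ij : 'I_n * 'I_n) : exists l, forall e, 0 < e ->
      G [set f | abs (m f ij.1 ij.2 - l) < e].
    apply: (ultra_limit hK UG (C := 1)).
    by apply: filterS Gsemi => f /hm; exact.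
  exists (\matrix_(i, j) L (i, j)) => e e0.
  have GL : G [set f | forall ij, abs (m f ij.1 ij.2 - L ij) < e].
    by apply: filter_forall => ij; exact: hL.
  by apply: filterS GL => f /= hf i j; rewrite mxE; exact: (hf (i, j)).
have [k0 hk0] := mx_limit k (fun f hf => let: And4 _ h _ _ := hk f hf in h).
have [k1 hk1] := mx_limit k' (fun f hf => let: And4 _ _ h _ := hk f hf in h).
(* The inverses are carried along for this: being integral they too have a limit, which inverts
   [k0]. *)
have k01 : k0 *m k1 = 1%:M.
  apply/matrixP => i j; apply/eqP; rewrite -subr_eq0 -(absK_eq0 R hK).
  rewrite eq_le (absK_ge0 R hK) andbT; apply/ler_addgt0Pl => e e0; rewrite addr0.
  pose d := Num.min 1 e; have d0 : 0 < d by rewrite lt_min ltr01.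
  have [f [/= [fs fk] fk']] := filter_ex (filterI (filterI Gsemi (hk0 d d0)) (hk1 d d0)).
  have [kk' kO k'O _] := hk f fs; rewrite -kk' !mxE -sumrB.
  apply: (absK_sum hK) => [|a _]; first exact: ltW.
  have -> : k0 i a * k1 a j - k f i a * k' f a j =
      - ((k f i a - k0 i a) * k1 a j) - k f i a * (k' f a j - k1 a j) by ring.
  have small (s t : K) : abs s < d -> abs t <= 1 -> abs (s * t) <= e.
    move=> hs ht; rewrite (absKM R hK) -[e]mulr1 ler_pM ?(absK_ge0 R hK) //.
    by rewrite (le_trans (ltW hs)) // ge_min lexx orbT.
  have k1O : abs (k1 a j) <= 1.
    have -> : k1 a j = k' f a j - (k' f a j - k1 a j) by ring.
    apply: (absKB_le hK) => //; apply: le_trans (ltW (fk' a j)) _.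
    by rewrite ge_min lexx.
  apply: (absKB_le hK); first by rewrite (absKN R hK) small.
  by rewrite mulrC small.
have [k0U _] := mulmx1_unit k01.
have [C C0 hC] := finite_ub (fun i => gam (e_ i) + 1).
have GC : G [set f | forall i, f (e_ i) <= C].
  have G1 : G [set f | forall i, `|f (e_ i) - gam (e_ i)| < 1].
    by apply: filter_forall => i; exact: Gcvg.
  apply: filterS G1 => f /= hf i.
  by have := hf i; have := hC i; rewrite ltr_norml => ? /andP[]; lra.
(* The constant [C] is the same for all [f] in a set of [G]; this equicontinuity lets [k f] be
   replaced by [k0] although [f] varies too. *)
have le_C f y : presem v q f -> (forall i, f (e_ i) <= C) ->
    forall t, 0 <= t -> (forall i, abs (y i ord0) <= t) -> f y <= t * C.
  move=> fs fC t t0 hy; apply: le_trans (presem_le_cphi fs y) _.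
  apply: cphi_le => [|i]; first by rewrite mulr_ge0 // ltW.
  by rewrite ler_pM ?(absK_ge0 R hK) ?(presem_ge0 fs).
have /choice[c0 hc0] i : exists l : R, 0 <= l /\ forall e, 0 < e ->
    G [set f | `|f (k f *m e_ i) - l| < e].
  apply: (ultra_limit_real UG (C := C)).
  apply: filterS (filterI Gsemi GC) => f /= [fs fC].
  rewrite (presem_ge0 fs) -[C]mul1r; apply: le_C => // j.
  by have [_ kO _ _] := hk f fs; rewrite -colE mxE.
have hlim e : 0 < e -> G [set f | (forall i j, abs (k f i j - k0 i j) < e) /\
    forall i, `|f (k f *m e_ i) - c0 i| < e].
  move=> e0; apply: filterI; first exact: hk0.
  by apply: filter_forall => i; exact: (hc0 i).2.
exists k0, c0; split=> //; first by move=> i; case: (hc0 i).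
suff E y : gam (k0 *m y) = cphi c0 y.
  by apply/funext => y; rewrite /act -E mulKVmx.
apply/eqP; rewrite -subr_eq0 -normr_le0; apply/ler_addgt0Pl => e e0; rewrite addr0.
have [Y Y0 hY] := absK_col_ub y.
have e3 : 0 < e / 3 by lra.
pose d := Num.min (e / 3 / Y / C) (e / 3 / Y).
have d0 : 0 < d by rewrite lt_min !divr_gt0.
have [f [/= [[fs fC] fy] [fk fc]]] := filter_ex
  (filterI (filterI (filterI Gsemi GC) (Gcvg (k0 *m y) e3)) (hlim d d0)).
have [_ _ _ fE] := hk f fs.
have h1 : `|f (k f *m y) - cphi c0 y| <= e / 3.
  rewrite fE; apply: cphi_dist => [|i|i|i]; first exact: ltW.
  - exact: (presem_ge0 fs).
  - by case: (hc0 i).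
  rewrite -mulrBr normrM [`|abs _|]ger0_norm ?(absK_ge0 R hK) //.
  have -> : e / 3 = Y * (e / 3 / Y) by rewrite [RHS]mulrC divfK // gt_eqF.
  rewrite ler_pM ?(absK_ge0 R hK) // (le_trans (ltW (fc i))) //.
  by rewrite ge_min lexx orbT.
have h2 : `|f (k f *m y) - f (k0 *m y)| <= e / 3.
  apply: le_trans (presem_dist hK fs _ _) _; rewrite -mulmxBl.
  have -> : e / 3 = e / 3 / Y / C * Y * C.
    by rewrite [_ / C * Y]mulrAC divfK ?gt_eqF // divfK // gt_eqF.
  apply: le_C => // [|i]; first by rewrite mulr_ge0 ?divr_ge0 // ltW.
  apply: absK_mulmx_le => // [||a b]; rewrite ?divr_ge0 ?ltW //.
  rewrite !mxE; apply: lt_le_trans (fk a b) _; by rewrite ge_min lexx.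
have : gam (k0 *m y) - cphi c0 y = (f (k f *m y) - cphi c0 y)
    - (f (k f *m y) - f (k0 *m y)) - (f (k0 *m y) - gam (k0 *m y)) by ring.
move=> ->; move: h1 h2 (ltW fy); rewrite !ler_norml => /andP[? ?] /andP[? ?] /andP[? ?].
by apply/andP; split; lra.
Qed.

End Limit.

Lemma Phi_open (W : 'M[K]_n * pt R n -> Prop) :
  XA_open R K v q n W -> Xsaturated R K v n W ->
  S_open R K v q n (fun gam => seminorm gam /\ exists2 a, W a & sn_equiv gam (Phi a)).
Proof.
move=> Wo Wsat; split; last first.
  move=> f f' fs f's ff' [_ [a Wa fa]]; split=> //; exists a => //.
  exact: sn_equiv_trans (sn_equiv_sym ff') fa.
split=> [f []//|gam [gs [a Wa ga]]]; apply: contrapT => none.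
(* Counterexamples for every finite set of vectors and every precision generate a filter; an
   ultrafilter above it converges to [gam] while avoiding the image of [W]. *)
pose bad (Fe : seq 'cV[K]_n * R) := [set f | [/\ seminorm f,
  forall w, w \in Fe.1 -> `|f w - gam w| < Fe.2 & ~ exists2 a, W a & sn_equiv f (Phi a)]].
have badP Fe : 0 < Fe.2 -> bad Fe !=set0.
  move=> e0; apply: contrapT => h; apply: none; exists Fe.1, Fe.2 => // f fs hf.
  by split=> //; apply: contrapT => hW; apply: h; exists f.
have FF : ProperFilter (filter_from [set Fe : seq 'cV[K]_n * R | 0 < Fe.2] bad).
  apply: filter_from_proper => //; apply: filter_from_filter.
    by exists ([::], 1) => /=.
  move=> [F e] [F' e'] /= e0 e'0; exists (F ++ F', Num.min e e'); first by rewrite /= lt_min e0.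
  move=> f [fs hf nf]; split; split=> // w wF.
    by have := hf w; rewrite mem_cat wF => /(_ isT); rewrite lt_min => /andP[].
  by have := hf w; rewrite mem_cat wF orbT => /(_ isT); rewrite lt_min => /andP[].
have [G [UG FG]] := ultraFilterLemma FF.
have Gbad Fe : 0 < Fe.2 -> G (bad Fe) by move=> e0; apply: FG; exists Fe.
have Gcvg w e : 0 < e -> G [set f | `|f w - gam w| < e].
  move=> e0; apply: filterS (Gbad ([:: w], e) e0) => f [_ h _].
  by apply: h; rewrite mem_head.
have Gsemi : G [set f | presem v q f].
  by apply: filterS (Gbad ([::], 1) ltr01) => f [/seminorm_presem].
have /choice[kk hkk] (f : 'cV[K]_n -> R) : exists kk : 'M[K]_n * 'M[K]_n,
    presem v q f -> [/\ kk.1 *m kk.2 = 1%:M, integral_mx R v q kk.1,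
      integral_mx R v q kk.2 &
      forall y, f (kk.1 *m y) = cphi (fun i => f (kk.1 *m e_ i)) y].
  have [hf|hf] := pselect (presem v q f); last by exists (1%:M, 1%:M).
  by have [k [k' hkk']] := orthogonal_basis hK hf; exists (k, k').
have [k0 [c0 [k0U c00 gamE hlim]]] :=
  split_limit UG Gsemi Gcvg (k := fun f => (kk f).1) (k' := fun f => (kk f).2) hkk.
have gs0 := gs; rewrite gamE in gs0; have [i ci] := act_cphi_pos c00 gs0.
have p0A : inAbar R n (ofcoord q c0) by apply: ofcoord_inAbar; exists i.
(* The limit pair represents the class of [gam] but need not be [a]; injectivity relates the two and
   saturation puts it in [W]. *)
have W0 : W (k0, ofcoord q c0).
  have [[aU aA] _] := Wo a Wa; apply: (iffLR (Wsat a _ _) Wa).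
  apply: (Phi_inj hK) => //; apply: sn_equiv_trans (sn_equiv_sym ga) _.
  by rewrite gamE; exact: sn_equiv_cphi.
have [_ [V1 [V2 [V1o V2o V1k V2p V12]]]] := Wo _ W0.
have [_ [e1 e10 he1]] := V1o _ V1k.
have [e2 e20 he2] := open_coord_nbhs hK V2o V2p p0A.
have [l0 l00 hl0] := coord_ofcoord hK c00.
pose e := Num.min e1 (e2 / l0); have e0 : 0 < e by rewrite lt_min e10 divr_gt0.
have [f [/= [fs _ nf] [fk fc]]] := filter_ex (filterI (Gbad ([::], 1) ltr01) (hlim e e0)).
have [kk' _ _ fE] := hkk f (seminorm_presem fs).
have [kU _] := mulmx1_unit kk'.
pose c j := f ((kk f).1 *m e_ j); have cge j : 0 <= c j by exact: (presem_ge0 (seminorm_presem fs)).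
have feq : f = act R K n (kk f).1 (cphi c).
  by apply/funext => y; rewrite /act -fE mulKVmx.
have fs0 := fs; rewrite feq in fs0; have [j cj] := act_cphi_pos cge fs0.
have [l lgt hl] := coord_ofcoord hK cge.
apply: nf; exists ((kk f).1, ofcoord q c); last first.
  by rewrite [X in sn_equiv X _]feq; exact: sn_equiv_cphi.
apply: V12.
  by apply: he1 => // a' b'; apply: lt_le_trans (fk a' b') _; rewrite ge_min lexx.
(* The two points are normalized by different factors, [l] and [l0]; the quotient aligns them,
   leaving [c] to be compared with [c0]. *)
apply: (he2 _ (l0 / l)); [by apply: ofcoord_inAbar; exists j | exact: divr_gt0 |].
move=> b'; rewrite hl hl0 mulrA divfK ?gt_eqF // -mulrBr normrM gtr0_norm //.
rewrite mulrC -ltr_pdivlMr //; apply: lt_le_trans (fc b') _.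
by rewrite ge_min lexx orbT.
Qed.

End Topology.

Theorem theorem5p1 (R : realType) (K : fieldType) (v : K -> int) (q n : nat) :
  nonarch_local_field K v q ->
  (* the map lands in S *)
  (forall a : 'M[K]_n * pt R n, GLn K n a.1 -> inAbar R n a.2 ->
     seminorm R K v q n (Phi R K v q n a)) /\
  (* well defined on Xbar *)
  (forall a b, Xrel R K v n a b -> sn_equiv R K n (Phi R K v q n a) (Phi R K v q n b)) /\
  (* injective *)
  (forall a b : 'M[K]_n * pt R n,
     GLn K n a.1 -> inAbar R n a.2 -> GLn K n b.1 -> inAbar R n b.2 ->
     sn_equiv R K n (Phi R K v q n a) (Phi R K v q n b) ->
     clos_refl_sym_trans _ (Xrel R K v n) a b) /\
  (* surjective *)
  (forall gam, seminorm R K v q n gam ->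
     exists a : 'M[K]_n * pt R n,
       [/\ GLn K n a.1, inAbar R n a.2 & sn_equiv R K n gam (Phi R K v q n a)]) /\
  (* G-equivariant *)
  (forall (k : 'M[K]_n) (a : 'M[K]_n * pt R n),
     GLn K n k -> GLn K n a.1 -> inAbar R n a.2 ->
     sn_equiv R K n (Phi R K v q n (k *m a.1, a.2)) (act R K n k (Phi R K v q n a))) /\
  (* continuous *)
  (forall O, S_open R K v q n O ->
     XA_open R K v q n
       (fun a => [/\ GLn K n a.1, inAbar R n a.2 & O (Phi R K v q n a)])) /\
  (* open (inverse continuous) *)
  (forall W, XA_open R K v q n W -> Xsaturated R K v n W ->
     S_open R K v q n (fun gam => seminorm R K v q n gam /\
                   exists2 a, W a & sn_equiv R K n gam (Phi R K v q n a))).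
Proof.
move=> hK; split; first exact: (Phi_seminorm hK).
split; first exact: (Phi_Xrel hK).
split.
  (* [Phi_inj] yields the relation itself, so a chain of length one suffices. *)
  move=> a c aU aA cU cA h; apply: rst_step.
  exact: (Phi_inj hK).
split; first exact: (Phi_surj hK).
split.
  move=> k [g x] /= kU gU xA; rewrite /Phi /= act_mul //.
  exact: sn_equiv_refl.
split; first exact: (Phi_cts hK).
exact: (Phi_open hK).
Qed.
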